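(* There exist a Polish space $X$ and a continuous finite-to-one function $f:X\to X$ such that the Borel chromatic number of $\mathcal{G}_f$ equals $\aleph_0$ and there is no Borel homomorphism from $\mathcal{G}_{\mathsf{S}}$ to $\mathcal{G}_f$.
   Context: A directed graph is a pair $\mathcal{G}=(X,R)$ with $R$ an irreflexive binary relation on $X$. A homomorphism from $(X,R)$ to $(X',R')$ is a map $h:X\to X'$ such that $(x,y)\in R$ implies $(h(x),h(y))\in R'$. A coloring of $(X,R)$ is a map $c:X\to Y$ with $c(x_1)\neq c(x_2)$ whenever $(x_1,x_2)\in R$. For $X$ a topological space, the Borel chromatic number of $\mathcal{G}$ is the minimum of $|c(X)|$ over all Borel colorings $c:X\to Y$ of $\mathcal{G}$ into Polish spaces $Y$. For a Polish space $X$ and Borel $f:X\to X$, $\mathcal{G}_f=(X,R_f)$ where $x\mathrel{R_f}y$ iff $x\neq y$ and ($f(x)=y$ or $f(y)=x$). Let $[\omega]^\omega$ be the set of infinite subsets of $\omega$, with the topology induced from $2^\omega$ via characteristic functions, and $\mathsf{S}:[\omega]^\omega\to[\omega]^\omega$, $\mathsf{S}(Y)=Y\setminus\{\min Y\}$ (the shift); $\mathcal{G}_{\mathsf{S}}$ is the graph $\mathcal{G}_f$ for $f=\mathsf{S}$ on $X=[\omega]^\omega$. *)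

(* Defs.v *)
From HB Require Import structures.
From mathcomp Require Import all_boot all_order all_algebra.
From mathcomp Require Import all_classical all_reals.
From mathcomp Require Import topology measure cantor.

Set Implicit Arguments.
Unset Strict Implicit.
Unset Printing Implicit Defensive.

Local Open Scope classical_set_scope.
Local Open Scope card_scope.

Definition separable_space (T : topologicalType) :=
  exists2 D : set T, countable D & dense D.

(* The library's [completeType] is restricted to pointed types; the condition
   below is its axiom, stated for a possibly empty uniform space. *)
Definition complete_space (T : uniformType) :=
  forall F : set_system T, ProperFilter F -> cauchy F -> exists x : T, F --> x.

Definition homeomorphic (S T : topologicalType) :=
  exists (f : S -> T) (g : T -> S),
    [/\ cancel f g, cancel g f, continuous f & continuous g].

(* [R] is only the field in which metrics take their values. *)
Definition completely_metrizable (R : realType) (T : topologicalType) :=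
  exists2 M : metricType R, complete_space M & homeomorphic T M.

Definition polish_space (R : realType) (T : topologicalType) :=
  separable_space T /\ completely_metrizable R T.

Definition borel_set (T : topologicalType) : set (set T) := <<s open >>.

Definition borel_fun (S T : topologicalType) (f : S -> T) :=
  forall B : set T, borel_set B -> borel_set (f @^-1` B).

Record digraph (X : Type) := Digraph {
  edge :> X -> X -> Prop;
  edge_irreflexive : forall x, ~ edge x x }.

Definition graph_homomorphism (X X' : Type) (G : digraph X) (G' : digraph X')
    (h : X -> X') :=
  forall x y, G x y -> G' (h x) (h y).

Definition coloring (X Y : Type) (G : digraph X) (c : X -> Y) :=
  forall x1 x2, G x1 x2 -> c x1 <> c x2.

Definition borel_coloring (X Y : topologicalType) (G : digraph X)
    (c : X -> Y) :=
  coloring G c /\ borel_fun c.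

(* A cardinal is represented by a set [K] of that cardinality: the predicate
   says that the minimum of |c(X)|, over all Borel colorings c of G into
   Polish spaces, is attained and equal to |K|. *)
Definition borel_chromatic_number_is (R : realType) (X : topologicalType)
    (G : digraph X) (T : Type) (K : set T) :=
  (exists (Y : topologicalType) (c : X -> Y),
     [/\ polish_space R Y, borel_coloring G c & range c #= K]) /\
  (forall (Y : topologicalType) (c : X -> Y),
     polish_space R Y -> borel_coloring G c -> K #<= range c).

Definition function_edge (X : Type) (f : X -> X) (x y : X) :=
  x <> y /\ (f x = y \/ f y = x).

Lemma function_edge_irreflexive (X : Type) (f : X -> X) (x : X) :
  ~ function_edge f x x.
Proof. by case. Qed.

Definition function_graph (X : Type) (f : X -> X) : digraph X :=
  Digraph (@function_edge_irreflexive X f).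

Definition finite_to_one (X Y : Type) (f : X -> Y) :=
  forall y, finite_set (f @^-1` [set y]).

Definition infsub : Type := set_type [set A : set nat | infinite_set A].

Definition infsub_set (A : infsub) : set nat := set_val A.

Definition infsub_char (A : infsub) : cantor_space :=
  fun n => `[< infsub_set A n >].

HB.instance Definition _ := Choice.on infsub.
HB.instance Definition _ :=
  Topological.copy infsub (initial_topology infsub_char).

(* The default value 0 is irrelevant for nonempty [A]. *)
Definition min_nat (A : set nat) : nat :=
  xget 0 [set m | A m /\ forall n, A n -> m <= n].

Lemma shift_subproof (A : infsub) :
  infsub_set A `\ min_nat (infsub_set A) \in
    [set B : set nat | infinite_set B].
Proof.
apply/mem_set => /= fin.
apply: (set_mem (valP A)).
apply: (@sub_finite_set _ _
  ((infsub_set A `\ min_nat (infsub_set A)) `|` [set min_nat (infsub_set A)])).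
  move=> n An; have [->|nm] := eqVneq n (min_nat (infsub_set A)).
    by right.
  by left; split => //; apply/eqP.
by rewrite finite_setU; split => //; exact: finite_set1.
Qed.

Definition shift (A : infsub) : infsub :=
  exist (fun B : set nat => B \in [set B : set nat | infinite_set B])
    (infsub_set A `\ min_nat (infsub_set A)) (shift_subproof A).

Definition shift_graph : digraph infsub := function_graph shift.

(* Main.v *)
From HB Require Import structures.
Require Import Defs.
From mathcomp Require Import all_boot all_order all_algebra.
From mathcomp Require Import all_classical all_reals.
From mathcomp Require Import topology measure cantor.
From mathcomp Require Import zify.

(** A point of [X] is a triple (r, y, N), where r codes a finite family of
    Borel sets, y is an increasing sequence and N_n is the least length at which
    no node of a tree T_r lies below the n-th tail of y; thus no tail of y
    dominates a branch of T_r. The map drops the first terms of y and N.  The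
    branches of T_r are the witnesses that the family coded by r is not a
    correct finite Borel coloring on the fibre over r. This self-reference is
    resolved by recursion on the length of the nodes.
    - T_r always has a branch: otherwise the fibre contains every increasing
      sequence, and r would code a finite Borel coloring of the shift graph on
      infinite sets, against the Galvin-Prikry theorem.
    - A finite Borel coloring of [X] has a code r, and no branch of T_r could
      then exist; hence the Borel chromatic number is infinite.
    - By Galvin-Prikry, a Borel homomorphism from the shift graph has on some
      [Z]^omega values in a single fibre r, with first term tending to infinity
      along the shift; on a sparse enough set the value of y dominates a
      branch of T_r, a contradiction. *)

Set Implicit Arguments.
Unset Strict Implicit.
Unset Printing Implicit Defensive.

Import Order.TTheory GRing.Theory Num.Theory.

Local Open Scope classical_set_scope.
Local Open Scope nat_scope.

(** * Completely Ramsey families *)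

Definition unbounded (Z : set nat) := forall m, exists2 n, m <= n & Z n.

Definition above (a : nat) (Z : set nat) : set nat := [set n | Z n /\ a <= n].

Definition below (a : nat) (Z : set nat) : set nat := [set n | Z n /\ n < a].

Definition homogeneous (P : set (set nat)) (Z : set nat) :=
  (forall Y, Y `<=` Z -> unbounded Y -> P Y) \/
  (forall Y, Y `<=` Z -> unbounded Y -> ~ P Y).

Definition ramsey (P : set (set nat)) :=
  forall Z, unbounded Z ->
    exists Z', [/\ Z' `<=` Z, unbounded Z' & homogeneous P Z'].

Definition initial_part (a : nat) (t : set nat) := t `<=` `I_a.

Definition section_at (P : set (set nat)) (t : set nat) : set (set nat) :=
  [set Y | P (t `|` Y)].

(** Quantifying over finite stems [t] is what makes the class closed under countable unions: a
    fusion can then treat the sections at all stems in turn. *)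
Definition completely_ramsey (P : set (set nat)) :=
  forall a t, initial_part a t -> ramsey (section_at P t).

(** Openness, among infinite sets, in the topology of characteristic functions: [below a Y] is a
    finite piece of that of [Y]. *)
Definition finitely_determined (P : set (set nat)) :=
  forall Y, unbounded Y -> P Y ->
    exists a, forall Y', unbounded Y' -> below a Y' = below a Y -> P Y'.

Lemma above_mono a b Z : a <= b -> above b Z `<=` above a Z.
Proof. by move=> ab n [Zn bn]; split=> //; exact: leq_trans bn. Qed.

Lemma above_subset a Z Z' : Z `<=` Z' -> above a Z `<=` above a Z'.
Proof. by move=> ZZ n [Zn an]; split=> //; exact: ZZ. Qed.

Lemma unbounded_sub Y Y' : Y `<=` Y' -> unbounded Y -> unbounded Y'.
Proof. by move=> YY uY m; have [n mn Yn] := uY m; exists n => //; exact: YY. Qed.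

Lemma unbounded_above a Z : unbounded Z -> unbounded (above a Z).
Proof.
move=> uZ m; have [n mn Zn] := uZ (maxn a m).
by exists n; [lia|split => //; lia].
Qed.

Lemma below_above a Y : below a Y `|` above a Y = Y.
Proof.
apply/seteqP; split => [n [[]|[]]//|n Yn].
by case: (ltnP n a) => an; [left|right].
Qed.

Lemma homogeneous_sub P Z Z' : Z' `<=` Z -> homogeneous P Z -> homogeneous P Z'.
Proof.
by move=> ZZ [h|h]; [left|right] => Y YZ; apply: h => n /YZ /ZZ.
Qed.

(** * Fusion of infinite sets *)

Section fusion.
Variables (D : nat -> set nat -> set nat -> Prop) (Z : set nat).
Hypothesis Dsub : forall a t W W', W' `<=` W -> D a t W -> D a t W'.
Hypothesis Ddense : forall a t W, initial_part a t -> W `<=` above a Z ->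
  unbounded W -> exists W', [/\ W' `<=` W, unbounded W' & D a t W'].

(** Only finitely many stems lie below [a], so [W] is shrunk once for each. The induction is on a
    bound [b] separate from [a], with the property [E] left general so that it can be replaced by
    [E2]. *)
Lemma dense_initial_parts a W : W `<=` above a Z -> unbounded W ->
  exists W', [/\ W' `<=` W, unbounded W' &
    forall t, initial_part a t -> D a t W'].
Proof.
have H : forall b (E : set nat -> set nat -> Prop),
    (forall t W W', W' `<=` W -> E t W -> E t W') ->
    (forall t W, initial_part b t -> W `<=` above a Z -> unbounded W ->
       exists W', [/\ W' `<=` W, unbounded W' & E t W']) ->
    forall W, W `<=` above a Z -> unbounded W ->
    exists W', [/\ W' `<=` W, unbounded W' &
       forall t, initial_part b t -> E t W'].
  elim=> [|b IH] E Esub Edense {}W WZ uW.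
    have t0 : initial_part 0 set0 by [].
    have [W' [W'W uW' EW']] := Edense _ _ t0 WZ uW.
    exists W'; split => // t; rewrite /initial_part II0 subset0 => -> //.
  have subS (t : set nat) : initial_part b t -> initial_part b.+1 t.
    by move=> tb n /tb /= ?; lia.
  have [W1 [W1W uW1 EW1]] := IH E Esub (fun t W tb => Edense t W (subS _ tb))
    W WZ uW.
  (* Stems that omit [b] are served by [E], those that contain it by [E2]. *)
  pose E2 t W := E (b |` t) W.
  have E2sub : forall t W W', W' `<=` W -> E2 t W -> E2 t W'.
    by move=> t ? ?; exact: Esub.
  have [|W2 [W2W1 uW2 EW2]] := IH E2 E2sub _ W1 (subset_trans W1W WZ) uW1.
    move=> t W' tb; apply: Edense => n /= [->|/tb /=] //; lia.
  exists W2; split => //; first exact: subset_trans W1W.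
  move=> t tb; have [bt|nbt] := pselect (t b); last first.
    apply: Esub W2W1 _; apply: EW1 => n tn /=.
    have /= := tb _ tn; rewrite ltnS leq_eqVlt => /orP[/eqP nb|//].
    by rewrite nb in tn.
  rewrite -(setD1K bt); apply: EW2 => n [tn /eqP nb] /=.
  have /= := tb _ tn; lia.
move=> WZ uW; apply: (H a (D a)) => // t V; [exact: Dsub|exact: Ddense].
Qed.

(** Pick [k n] in [W n], then shrink to [W n.+1] beyond [k n], good for all stems below [(k n).+1].
    The set of all [k n] works, since its part above [k n] lies in [W n.+1]. *)
Lemma fusion : unbounded Z -> exists Z', [/\ Z' `<=` Z, unbounded Z' &
  forall k t, Z' k -> initial_part k.+1 t -> D k.+1 t (above k.+1 Z')].
Proof.
move=> uZ; pose S := {W : set nat | W `<=` Z /\ unbounded W}.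
have step (W : S) : exists p : nat * S, [/\ sval W p.1,
    sval p.2 `<=` above p.1.+1 (sval W) &
    forall t, initial_part p.1.+1 t -> D p.1.+1 t (sval p.2)].
  case: W => W [WZ uW] /=; have [k _ Wk] := uW 0.
  have [|W' [W'W uW' DW']] :=
    @dense_initial_parts k.+1 (above k.+1 W) _ (unbounded_above _ uW).
    exact: above_subset WZ.
  have W'Z : W' `<=` Z /\ unbounded W' by split => // n /W'W [/WZ].
  by exists (k, exist _ W' W'Z).
have [g gP] := choice step.
have S0 : Z `<=` Z /\ unbounded Z by split.
pose W n := iter n (fun W => (g W).2) (exist _ Z S0 : S).
pose k n := (g (W n)).1.
have Wk n : sval (W n) (k n) by have [] := gP (W n).
have WS n : sval (W n.+1) `<=` above (k n).+1 (sval (W n)).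
  by have [] := gP (W n).
have Wmono m n : m <= n -> sval (W n) `<=` sval (W m).
  move/subnK <-; elim: (n - m) => [//|d IH] x /WS [Wx _]; exact: IH.
have kmono m n : m < n -> k m < k n.
  by move=> mn; have /WS [] := Wmono _ _ mn _ (Wk n).
have kn n : n <= k n.
  by elim: n => // n IH; apply: leq_ltn_trans IH _; exact: kmono.
exists (range k); split.
- by move=> _ [n _ <-]; exact: (Wmono 0 n (leq0n n) _ (Wk n)).
- by move=> m; exists (k m) => //; exists m.
move=> _ t [n _ <-] tn.
have [_ _ DW] := gP (W n).
apply: Dsub (DW t tn) => _ [[m _ <-] km].
apply: (Wmono n.+1 m); last exact: Wk.
by rewrite ltnNge; apply/negP; rewrite leq_eqVlt => /orP[/eqP mn|/kmono];
  [rewrite mn ltnn in km|lia].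
Qed.

End fusion.

(** * Complements, open families and countable unions *)

Lemma ramsey_setC P : ramsey P -> ramsey (~` P).
Proof.
move=> RP Z /RP [Z' [ZZ uZ [h|h]]]; exists Z'; split => //; [right|left].
  by move=> Y YZ uY; apply; exact: h.
exact: h.
Qed.

Lemma completely_ramsey_setC P : completely_ramsey P -> completely_ramsey (~` P).
Proof. by move=> RP a t /RP /ramsey_setC. Qed.

(* Combinatorial forcing: [W] accepts [t] when [section_at P t] holds on all
   infinite subsets of [W], and rejects it when no infinite subset accepts. *)
Section open_ramsey.
Variable P : set (set nat).
Hypothesis P_open : finitely_determined P.

Let accept (t W : set nat) :=
  forall Y, Y `<=` W -> unbounded Y -> P (t `|` Y).
Let reject (t W : set nat) :=
  forall W', W' `<=` W -> unbounded W' -> ~ accept t W'.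

Let accept_sub t W W' : W' `<=` W -> accept t W -> accept t W'.
Proof. by move=> WW aW Y YW; apply: aW; exact: subset_trans WW. Qed.

Let reject_sub t W W' : W' `<=` W -> reject t W -> reject t W'.
Proof. by move=> WW aW Y YW; apply: aW; exact: subset_trans WW. Qed.

(** A first fusion gives [Z] deciding every nonempty stem whose greatest element is in [Z]. If no
    infinite subset of [Z] accepts the empty stem, a second fusion gives [W] along which rejection
    passes from a stem to its one-point extensions; openness then keeps every infinite subset of [W]
    out of [P]. *)
Lemma ramsey_open : ramsey P.
Proof.
move=> Z0 uZ0.
pose D1 (_ : nat) t W := accept t W \/ reject t W.
have [|a t W _ _ uW|Z [ZZ0 uZ DZ]] := @fusion D1 Z0 _ _ uZ0.
- by move=> a t W W' WW [/accept_sub|/reject_sub] h; [left|right]; exact: h.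
- have [[W' [WW uW' aW]]|nW] :=
    pselect (exists W', [/\ W' `<=` W, unbounded W' & accept t W']).
    by exists W'; split => //; left.
  by exists W; split => //; right => W' WW uW' aW; apply: nW; exists W'.
have decide a t : initial_part a t -> Z a -> D1 a (a |` t) (above a.+1 Z).
  by move=> ta Za; apply: DZ => // n /= [->//|/ta /=]; lia.
have [[W [WZ uW aW]]|rZ] :=
    pselect (exists W', [/\ W' `<=` Z, unbounded W' & accept set0 W']).
  exists W; split => //; first exact: subset_trans ZZ0.
  by left => Y YW uY; rewrite -(set0U Y); exact: aW.
pose D2 a t W := reject t (above a Z) ->
  forall j, W j -> reject (j |` t) (above j.+1 Z).
(* If only boundedly many [j] in [W] preserved rejection, every later [j] would give an accepted
   stem; splitting each [Y] at its least element, the rest of [W] would accept [t]. *)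
have D2dense a t W : initial_part a t -> W `<=` above a Z -> unbounded W ->
    exists W', [/\ W' `<=` W, unbounded W' & D2 a t W'].
  move=> ta WZ uW.
  have [rt|nrt] := pselect (reject t (above a Z)); last first.
    by exists W; split => // /nrt.
  pose W1 := [set j | W j /\ reject (j |` t) (above j.+1 Z)].
  have [uW1|] := pselect (unbounded W1).
    by exists W1; split => //; [move=> j []|move=> _ j [_ rj]].
  move/existsNP => [m /forall2NP mW1]; exfalso.
  apply: (rt (above m W)); first by move=> n [] /WZ.
    exact: unbounded_above.
  move=> Y YW uY.
  have [j Yj jmin] : exists2 j, Y j & forall i, Y i -> j <= i.
    have exY : exists j, `[< Y j >].
      by have [j _ Yj] := uY 0; exists j; apply/asboolP.
    case: (ex_minnP exY) => j /asboolP Yj jmin; exists j => // i Yi.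
    by apply: jmin; apply/asboolP.
  have [Wj mj] := YW _ Yj; have [Zj aj] := WZ _ Wj.
  have tj : initial_part j t by move=> n /ta /=; lia.
  have [] := decide _ _ tj Zj; last first.
    move=> rj; have [|] := mW1 j; first by rewrite mj.
    by case; split.
  move=> /(_ (above j.+1 Y)).
  suff -> : (j |` t) `|` above j.+1 Y = t `|` Y.
    apply; last exact: unbounded_above.
    by move=> n [Yn jn]; split => //; have [/WZ []] := YW _ Yn.
  apply/seteqP; split => n.
    by move=> [[->|tn]|[Yn _]]; [right|left|right].
  move=> [tn|Yn]; first by left; right.
  have := jmin _ Yn; rewrite leq_eqVlt => /orP[/eqP <-|jn]; first by left; left.
  by right.
have aZ0 : above 0 Z = Z by apply/seteqP; split => [n []//|n Zn]; split.
have [||W0 [W0Z uW0 D2W0]] := D2dense 0 set0 Z _ _ uZ.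
- by [].
- by rewrite aZ0.
have {}D2W0 : forall j, W0 j -> reject [set j] (above j.+1 Z).
  move=> j W0j; rewrite -(setU0 [set j]); apply: D2W0 => //.
  by rewrite aZ0 => W' WZ uW' aW; apply: rZ; exists W'.
have [|a t W ta WW uW|W [WW0 uW D2W]] := @fusion D2 W0 _ _ uW0.
- by move=> a t W W' WW h /h {}h j /WW /h.
- by apply: D2dense => // n /WW [/W0Z].
exists W; split => //; first by move=> n /WW0 /W0Z /ZZ0.
right => Y YW uY PY.
(* Induction along [Y]: either [k] has a predecessor [i] in [Y], and [D2] passes rejection on from
   there, or [k] is the least element. *)
have rY k : Y k -> reject (below k.+1 Y) (above k.+1 Z).
  elim/ltn_ind: k => k IH Yk.
  have [[i [ik Yi imax]]|nYk] := pselect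
    (exists i, [/\ i < k, Y i & forall l, Y l -> l < k -> l <= i]).
    have -> : below k.+1 Y = k |` below i.+1 Y.
      apply/seteqP; split => n.
        move=> [Yn]; rewrite ltnS leq_eqVlt => /orP[/eqP ->|nk]; first by left.
        by right; split => //; exact: imax.
      by move=> [->|[Yn ni]]; split => //; lia.
    apply: (D2W i _ (YW _ Yi)); [by move=> n []|exact: IH|].
    by split => //; exact: YW.
  suff -> : below k.+1 Y = [set k] by apply: D2W0; apply/WW0/YW.
  apply/seteqP; split => [n [Yn nk]|_ ->]; last by split.
  apply/eqP; rewrite eqn_leq -ltnS nk /= leqNgt; apply/negP => {}nk.
  apply: nYk.
  have exY : exists j, `[< Y j >] && (j < k).
    by exists n; rewrite nk andbT; apply/asboolP.
  have ubY j : `[< Y j >] && (j < k) -> j <= k by move=> /andP[_]; lia.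
  case: (ex_maxnP exY ubY) => j /andP[/asboolP Yj jk] jmax.
  by exists j; split => // l Yl lk; apply: jmax; rewrite lk andbT; apply/asboolP.
(* A finite segment of [Y] forces membership in [P], so it is accepted, against [rY]. *)
have [a aP] := P_open uY PY.
have [k ak Yk] := uY a.
apply: (rY k Yk (above k.+1 Z)) => //; first exact: unbounded_above.
move=> Y' YZ uY'; apply: aP.
  by apply: unbounded_sub uY'; exact: subsetUr.
apply/seteqP; split => [n [[[]//|/YZ [_]]]|n [Yn na]]; first by lia.
by split => //; left; split => //; lia.
Qed.

End open_ramsey.

Lemma below_setU_eq a t Y Y' : below a Y' = below a Y ->
  below a (t `|` Y') = below a (t `|` Y).
Proof.
move=> YY; apply/seteqP; split => n [[tn|Yn] na]; split => //; try by left.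
  by right; have [] : below a Y n by rewrite -YY.
by right; have [] : below a Y' n by rewrite YY.
Qed.

Lemma finitely_determined_section P t :
  finitely_determined P -> finitely_determined (section_at P t).
Proof.
move=> Po Y uY PY.
have uU (X : set nat) : unbounded X -> unbounded (t `|` X).
  by apply: unbounded_sub; exact: subsetUr.
have [a aP] := Po _ (uU _ uY) PY; exists a => Y' uY' YY'.
by apply: aP; [exact: uU|exact: below_setU_eq].
Qed.

Lemma completely_ramsey_open P : finitely_determined P -> completely_ramsey P.
Proof. by move=> Po a t _; apply/ramsey_open/finitely_determined_section. Qed.

Lemma completely_ramsey_section a P t : initial_part a t ->
  completely_ramsey P -> completely_ramsey (section_at P t).
Proof.
move=> ta RP b s sb.
have -> : section_at (section_at P t) s = section_at P (t `|` s).
  by apply/seteqP; split => Y; rewrite /section_at /= setUA.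
by apply: (RP (maxn a b)) => n /= [/ta|/sb] /=; lia.
Qed.

(* Fusing over the sets [P n] makes each of them relatively clopen on some
   [Z'], so that their union becomes relatively open. *)
Lemma ramsey_bigcup (P : nat -> set (set nat)) :
  (forall n, completely_ramsey (P n)) -> ramsey (\bigcup_n P n).
Proof.
move=> RP Z0 uZ0.
pose D a t W := forall n, n < a -> homogeneous (section_at (P n) t) W.
have [|a t W ta _ uW|Z [ZZ0 uZ DZ]] := @fusion D Z0 _ _ uZ0.
- by move=> a t W W' WW h n /h; exact: homogeneous_sub.
- rewrite /D; elim: {1}a => [|b [W1 [W1W uW1 DW1]]].
    by exists W; split.
  have [W2 [W2W1 uW2 DW2]] := RP b a t ta W1 uW1.
  exists W2; split => //; first exact: subset_trans W1W.
  move=> n; rewrite ltnS leq_eqVlt => /orP[/eqP ->//|nb].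
  by apply: homogeneous_sub W2W1 _; exact: DW1.
(* [Q] asks that a finite segment of [Y] force membership in some [P n]. It is open by its form and
   equals the union on subsets of [Z]. *)
pose Q Y := exists n k, [/\ n <= k, Z k &
  forall Y', Y' `<=` above k.+1 Z -> unbounded Y' -> P n (below k.+1 Y `|` Y')].
have Qo : finitely_determined Q.
  move=> Y uY [n [k [nk Zk PY]]]; exists k.+1 => Y' _ YY'.
  by exists n, k; split => // Y''; rewrite YY'; exact: PY.
have QP Y : Y `<=` Z -> unbounded Y -> Q Y <-> (\bigcup_n P n) Y.
  move=> YZ uY; split => [[n [k [nk Zk PY]]]|[n _ PY]].
    exists n => //; rewrite -(below_above k.+1 Y); apply: PY.
      exact: above_subset.
    exact: unbounded_above.
  have [k nk Yk] := uY n; exists n, k; split => //; first exact: YZ.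
  have tk : initial_part k.+1 (below k.+1 Y) by move=> m [].
  have [//|h] := DZ k _ (YZ _ Yk) tk n nk.
  exfalso; apply: (h (above k.+1 Y)); first exact: above_subset.
    exact: unbounded_above.
  by rewrite /section_at /= below_above.
have [Z' [ZZ uZ' hZ']] := ramsey_open Qo uZ.
exists Z'; split => //; first exact: subset_trans ZZ0.
case: hZ' => h; [left|right] => Y YZ uY.
  by apply/QP => //; [exact: subset_trans ZZ|exact: h].
by move/QP => PY; apply: (h Y) => //; apply: PY => //; exact: subset_trans ZZ.
Qed.

Lemma completely_ramsey_bigcup (P : nat -> set (set nat)) :
  (forall n, completely_ramsey (P n)) -> completely_ramsey (\bigcup_n P n).
Proof.
move=> RP a t ta.
have -> : section_at (\bigcup_n P n) t = \bigcup_n section_at (P n) t.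
  by apply/seteqP; split => Y [n _ PY]; exists n.
by apply: ramsey_bigcup => n; exact: completely_ramsey_section ta _.
Qed.

Lemma completely_ramsey_ramsey P : completely_ramsey P -> ramsey P.
Proof.
move=> /(_ 0 set0 (sub0set _)).
suff -> : section_at P set0 = P by [].
by apply/seteqP; split => Y; rewrite /section_at /= set0U.
Qed.

(** A fusion that ignores stems. The bound [a] must depend on [n]: for the families of sets
    containing [n], no infinite set is homogeneous for all of them. *)
Lemma ramsey_sequence (P : nat -> set (set nat)) Z :
  (forall n, ramsey (P n)) -> unbounded Z ->
  exists Z', [/\ Z' `<=` Z, unbounded Z' &
    forall n, exists a, homogeneous (P n) (above a Z')].
Proof.
move=> RP uZ.
pose D a (t : set nat) W := forall n, n < a -> homogeneous (P n) W.
have [|a t W ta _ uW|Z' [ZZ uZ' DZ]] := @fusion D Z _ _ uZ.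
- by move=> a t W W' WW h n /h; exact: homogeneous_sub.
- rewrite /D; elim: {1}a => [|b [W1 [W1W uW1 DW1]]].
    by exists W; split.
  have [W2 [W2W1 uW2 DW2]] := RP b W1 uW1.
  exists W2; split => //; first exact: subset_trans W1W.
  move=> n; rewrite ltnS leq_eqVlt => /orP[/eqP ->//|nb].
  by apply: homogeneous_sub W2W1 _; exact: DW1.
exists Z'; split => // n; have [k nk Zk] := uZ' n; exists k.+1.
by apply: (DZ k set0) => //; exact: sub0set.
Qed.

(** * Borel sets of infinite subsets of the naturals *)

Lemma infinite_unbounded (A : set nat) : infinite_set A <-> unbounded A.
Proof.
split=> [infA m|uA].
  apply: contrapT => nA; apply: infA.
  apply: (@sub_finite_set _ _ `I_m) => // n An /=.
  by rewrite ltnNge; apply/negP => mn; apply: nA; exists n.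
move=> /finite_seqP [s As].
have [n mn] := uA (\max_(i <- s) i).+1.
rewrite As /= => ns; move: mn; rewrite (big_rem n) //=; lia.
Qed.

Lemma infsub_unbounded (A : infsub) : unbounded (infsub_set A).
Proof. by apply/infinite_unbounded; exact: (set_mem (valP A)). Qed.

Lemma unboundedT : unbounded [set: nat].
Proof. by move=> m; exists m. Qed.

Definition infsub_of (Y : set nat) (uY : unbounded Y) : infsub :=
  exist (fun B : set nat => B \in [set B : set nat | infinite_set B])
    Y (mem_set ((infinite_unbounded Y).2 uY)).

Lemma infsub_ofK Y (uY : unbounded Y) : infsub_set (infsub_of uY) = Y.
Proof. by []. Qed.

Lemma infsub_set_inj : injective infsub_set.
Proof. exact: val_inj. Qed.

(** The cylinders at [x] generate a filter [F]; the topology is a supremum of initial ones, so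
    convergence of [F] to [x] can be checked one coordinate at a time. *)
Lemma cantor_nbhs_cylinder (x : cantor_space) (U : set cantor_space) :
  nbhs x U -> exists a, forall y : cantor_space,
    (forall n, n < a -> y n = x n) -> U y.
Proof.
pose F : set_system cantor_space := [set U | exists a, forall y : cantor_space,
    (forall n, n < a -> y n = x n) -> U y].
have FF : Filter F.
  split.
  - by exists 0.
  - move=> P Q [a Pa] [b Qb]; exists (maxn a b) => y yx.
    by split; [apply: Pa|apply: Qb] => n na; apply: yx; lia.
  - by move=> P Q PQ [a Pa]; exists a => y /Pa /PQ.
suff : F --> x by move=> h /h.
apply/cvg_sup => i A; rewrite nbhsE => -[B [[C oC <-] Bx] BA].
by exists i.+1 => y yx; apply: BA => /=; rewrite /proj yx.
Qed.

Definition carrier_sets (B : set infsub) : set (set nat) :=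
  [set Y | exists2 A, infsub_set A = Y & B A].

Lemma carrier_setsE (B : set infsub) A : carrier_sets B (infsub_set A) <-> B A.
Proof. by split=> [[A' /infsub_set_inj ->]|BA] //; exists A. Qed.

Lemma completely_ramsey_eq (P Q : set (set nat)) :
  (forall Y, unbounded Y -> P Y <-> Q Y) ->
  completely_ramsey P -> completely_ramsey Q.
Proof.
move=> PQ RP a t ta Z uZ; have [Z' [ZZ uZ' h]] := RP a t ta Z uZ.
have {}PQ Y : unbounded Y -> P (t `|` Y) <-> Q (t `|` Y).
  by move=> uY; apply: PQ; apply: unbounded_sub uY; exact: subsetUr.
exists Z'; split => //; case: h => h; [left|right] => Y YZ uY.
  by apply/PQ => //; exact: h.
by move=> /PQ - /(_ uY); exact: h.
Qed.

Lemma open_finitely_determined (O : set infsub) :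
  open O -> finitely_determined (carrier_sets O).
Proof.
move=> [U oU <-] Y uY [A AY OA].
have [a aU] := cantor_nbhs_cylinder (open_nbhs_nbhs (conj oU OA)).
exists a => Y' uY' YY'; exists (infsub_of uY'); first exact: infsub_ofK.
apply: aU => n na; rewrite /infsub_char infsub_ofK AY.
apply: asbool_equiv_eq; split => Yn.
  by have [] : below a Y n by rewrite -YY'.
by have [] : below a Y' n by rewrite YY'.
Qed.

(** The Galvin-Prikry theorem: completely Ramsey families form a sigma-algebra that contains the
    open ones. *)
Lemma borel_completely_ramsey (B : set infsub) :
  borel_set B -> completely_ramsey (carrier_sets B).
Proof.
move: B; apply: smallest_sub => [|O oO] /=; last first.
  exact/completely_ramsey_open/open_finitely_determined.
split.
- by apply: completely_ramsey_open => Y uY [A AY []].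
- move=> B /completely_ramsey_setC; apply: completely_ramsey_eq => Y uY.
  rewrite -(infsub_ofK uY); split=> [nB|/carrier_setsE[_ nB] /carrier_setsE //].
  by apply/carrier_setsE; split => // BA; apply: nB; apply/carrier_setsE.
- move=> B RB; apply: completely_ramsey_eq (completely_ramsey_bigcup RB).
  move=> Y uY; rewrite -(infsub_ofK uY).
  split=> [[n _ /carrier_setsE Bn]|/carrier_setsE[n _ Bn]].
    by apply/carrier_setsE; exists n.
  by exists n => //; apply/carrier_setsE.
Qed.

(** * Enumerating infinite sets of naturals *)

Definition remove_min (Y : set nat) : set nat := Y `\ min_nat Y.

Lemma infsub_shift A : infsub_set (shift A) = remove_min (infsub_set A).
Proof. by []. Qed.

Lemma min_natP Y : unbounded Y ->
  Y (min_nat Y) /\ forall n, Y n -> min_nat Y <= n.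
Proof.
move=> uY; have [n _ Yn] := uY 0.
have exY : exists j, `[< Y j >] by exists n; apply/asboolP.
have [m mP] : exists m, Y m /\ forall n, Y n -> m <= n.
  case: (ex_minnP exY) => j /asboolP Yj jmin; exists j; split => // i Yi.
  by apply: jmin; apply/asboolP.
exact: (@xgetPex _ 0 [set m | Y m /\ forall n, Y n -> m <= n]
  (ex_intro _ m mP)).
Qed.

Lemma min_nat_eq Y m : Y m -> (forall n, Y n -> m <= n) -> min_nat Y = m.
Proof.
move=> Ym mY; have [] := @xgetPex _ 0 [set m | Y m /\ forall n, Y n -> m <= n]
  (ex_intro _ m (conj Ym mY)).
rewrite -/(min_nat Y) => Yx xmin.
by apply/eqP; rewrite eqn_leq xmin // mY.
Qed.

Lemma unbounded_remove_min Y : unbounded Y -> unbounded (remove_min Y).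
Proof.
move=> uY m; have [n mn Yn] := uY (maxn m (min_nat Y).+1).
exists n; first by lia.
by split => // /= ?; lia.
Qed.

Definition drop_min n Y := iter n remove_min Y.

Lemma unbounded_drop_min n Y : unbounded Y -> unbounded (drop_min n Y).
Proof. by move=> uY; elim: n => // n; exact: unbounded_remove_min. Qed.

Lemma drop_minS n Y : drop_min n (remove_min Y) = drop_min n.+1 Y.
Proof. by rewrite /drop_min -iterSr. Qed.

Lemma drop_min_sub n Y : drop_min n Y `<=` Y.
Proof. by elim: n => // n IH i []/IH. Qed.

Definition enumerate (Y : set nat) (n : nat) : nat := min_nat (drop_min n Y).

Lemma enumerate_remove_min Y n : enumerate (remove_min Y) n = enumerate Y n.+1.
Proof. by rewrite /enumerate drop_minS. Qed.

Lemma enumerate_lt Y n : unbounded Y -> enumerate Y n < enumerate Y n.+1.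
Proof.
move=> uY; have [_ h] := min_natP (unbounded_drop_min n uY).
have [[Ym nm] _] := min_natP (unbounded_drop_min n.+1 uY).
by rewrite ltn_neqAle h // andbT eq_sym; apply/eqP.
Qed.

(** Take [a] beyond the first [n.+1] elements of [Y]. Sets that agree below [a] have the same
    minimum there, and still agree below [a] once it is removed. *)
Lemma enumerate_local n Y : unbounded Y -> exists a, forall Y',
  unbounded Y' -> below a Y' = below a Y ->
  forall i, i <= n -> enumerate Y' i = enumerate Y i.
Proof.
move=> uY.
have belowE a (U V : set nat) k : below a U = below a V -> k < a -> U k -> V k.
  by move=> UV ka Uk; have [] : below a V k by rewrite -UV.
have minE a (U V : set nat) : unbounded U -> unbounded V ->
    below a U = below a V -> min_nat V < a -> min_nat U = min_nat V.
  move=> uU uV UV Va; have [VV Vm] := min_natP uV.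
  apply: min_nat_eq => [|k Uk]; first exact: belowE (esym UV) Va VV.
  have [ka|ka] := ltnP k a; first by apply: Vm; exact: belowE UV ka Uk.
  by lia.
have [a Ha] : exists a, forall i, i <= n -> enumerate Y i < a.
  elim: n => [|n [a Ha]]; first by exists (enumerate Y 0).+1 => -[].
  exists (maxn a (enumerate Y n.+1).+1) => i.
  by rewrite leq_eqVlt => /orP[/eqP ->|/Ha]; lia.
exists a => Y' uY' YY'.
have dropE i : i <= n -> below a (drop_min i Y') = below a (drop_min i Y).
  elim: i => // i IH lt_in; have {}IH := IH (ltnW lt_in).
  have mE := minE _ _ _ (unbounded_drop_min i uY') (unbounded_drop_min i uY)
    IH (Ha i (ltnW lt_in)).
  rewrite /drop_min !iterS -/(drop_min i Y') -/(drop_min i Y) /remove_min mE.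
  by apply/seteqP; split => k [[Yk nk] ka]; split => //; split => //;
    [exact: belowE IH ka Yk|exact: belowE (esym IH) ka Yk].
move=> i lt_in; apply: minE (dropE _ lt_in) (Ha i lt_in).
  exact: unbounded_drop_min.
exact: unbounded_drop_min.
Qed.

Lemma increasing_geq (y : nat -> nat) : (forall n, y n < y n.+1) ->
  forall n, n <= y n.
Proof. by move=> yS; elim=> // n IH; exact: leq_ltn_trans IH (yS n). Qed.

Lemma increasing_mono (y : nat -> nat) : (forall n, y n < y n.+1) ->
  forall m n, m <= n -> y m <= y n.
Proof.
move=> yS m n /subnK <-; elim: (n - m) => // d IH.
exact: leq_trans IH (ltnW (yS _)).
Qed.

Lemma unbounded_range (y : nat -> nat) : (forall n, y n < y n.+1) ->
  unbounded (range y).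
Proof. by move=> yS m; exists (y m); [exact: increasing_geq|exists m]. Qed.

Lemma remove_min_range (y : nat -> nat) : (forall n, y n < y n.+1) ->
  remove_min (range y) = range (y \o succn).
Proof.
move=> yS; rewrite /remove_min (@min_nat_eq _ (y 0)); last 2 first.
- by exists 0.
- by move=> _ [n _ <-]; exact: increasing_mono.
apply/seteqP; split => [_ [[[|n] _ <-]]//= _|_ [n _ <-]]; first by exists n.
split; first by exists n.+1.
by move=> /= h; have := increasing_mono yS (leq0n n); have := yS n; lia.
Qed.

Lemma drop_min_range (y : nat -> nat) : (forall n, y n < y n.+1) ->
  forall j, drop_min j (range y) = range (fun n => y (j + n)).
Proof.
move=> yS; elim=> [//|j IH].
rewrite /drop_min iterS -/(drop_min j _) IH remove_min_range.
  by congr (_ @` _); apply/funext => n /=; rewrite addnS.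
by move=> n; rewrite addnS.
Qed.

(** * Closed sets of sequences as Polish spaces *)

Definition agree (I : countType) (n : nat) (x y : I -> nat) :=
  forall i, pickle i < n -> x i = y i.

Lemma agree_sym (I : countType) n (x y : I -> nat) : agree n x y -> agree n y x.
Proof. by move=> xy i /xy. Qed.

Lemma agree_trans (I : countType) n (x y z : I -> nat) :
  agree n x y -> agree n y z -> agree n x z.
Proof. by move=> xy yz i ilt; rewrite xy // yz. Qed.

Lemma agree_le (I : countType) m n (x y : I -> nat) :
  m <= n -> agree n x y -> agree m x y.
Proof. by move=> mn xy i im; apply: xy; exact: leq_trans mn. Qed.

Lemma agreeP (I : countType) (x y : I -> nat) : (forall n, agree n x y) -> x = y.
Proof. by move=> xy; apply/funext => i; exact: (xy (pickle i).+1). Qed.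

Section agree_dist.
Variables (R : realType) (I : countType).
Implicit Types x y z : I -> nat.
Local Open Scope ring_scope.

(** The least [n] found here is positive, because [agree 0] always holds. *)
Definition agree_dist x y : R :=
  if pselect (exists n, `[< ~ agree n x y >]) is left e
  then (ex_minn e)%:R^-1 else 0.

Lemma agree_dist_lt n x y : agree_dist x y < n.+1%:R^-1 <-> agree n.+1 x y.
Proof.
rewrite /agree_dist; case: pselect => [e|ne]; last first.
  split=> _; last by rewrite invr_gt0 ltr0n.
  by apply: contrapT => xy; apply: ne; exists n.+1; apply/asboolP.
case: ex_minnP => -[|m] /asboolP nxy mmin; first by case: nxy.
rewrite ltf_pV2 ?posrE ?ltr0n // ltr_nat; split=> [nm|xy].
  apply: contrapT => /asboolP /mmin; lia.
rewrite ltnNge; apply/negP => mn; apply: nxy; exact: agree_le xy.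
Qed.

Lemma agree_dist_ge0 x y : 0 <= agree_dist x y.
Proof. by rewrite /agree_dist; case: pselect => // e; rewrite invr_ge0 ler0n. Qed.

Lemma agree_distxx x : agree_dist x x = 0.
Proof. by rewrite /agree_dist; case: pselect => // -[n /asboolP []]. Qed.

Lemma agree_dist_eq0 x y : agree_dist x y = 0 -> x = y.
Proof.
move=> xy; apply: agreeP => n; apply: (@agree_le _ n n.+1) => //.
by apply/agree_dist_lt; rewrite xy invr_gt0 ltr0n.
Qed.

Lemma agree_distC x y : agree_dist x y = agree_dist y x.
Proof.
have h u v : agree_dist v u <= agree_dist u v.
  rewrite {1}/agree_dist; case: pselect => [e|_]; last exact: agree_dist_ge0.
  case: ex_minnP => -[|m] /asboolP nxy mmin; first by case: nxy.
  by rewrite leNgt; apply/negP => /agree_dist_lt /agree_sym.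
by apply/eqP; rewrite eq_le !h.
Qed.

Lemma agree_dist_triangle y x z :
  agree_dist x z <= agree_dist x y + agree_dist y z.
Proof.
rewrite {1}/agree_dist; case: pselect => [e|_]; last first.
  by rewrite addr_ge0 ?agree_dist_ge0.
case: ex_minnP => -[|m] /asboolP nxz mmin; first by case: nxz.
rewrite leNgt; apply/negP => lt; apply: nxz; apply: (@agree_trans _ _ _ y).
  by apply/agree_dist_lt; apply: le_lt_trans lt; rewrite lerDl agree_dist_ge0.
by apply/agree_dist_lt; apply: le_lt_trans lt; rewrite lerDr agree_dist_ge0.
Qed.

End agree_dist.

(* [R] is the field in which the metric takes its values. *)
Record baire_sub (R : realType) (I : countType) (P : set (I -> nat)) : Type :=
  BaireSub { coords : I -> nat; coordsP : P coords }.

Arguments BaireSub R {I P} coords coordsP.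

Section baire_sub.
Variables (R : realType) (I : countType) (P : set (I -> nat)).
Local Notation X := (baire_sub R P).

HB.instance Definition _ := gen_eqMixin X.
HB.instance Definition _ := gen_choiceMixin X.

Lemma coords_inj : injective (@coords R I P).
Proof.
move=> [x Px] [y Py] /= xy; case: y / xy Py => Py.
by rewrite (Prop_irrelevance Px Py).
Qed.

Let d (x y : X) : R := agree_dist R (coords x) (coords y).

Let dxx x : d x x = 0%R. Proof. exact: agree_distxx. Qed.
Let d_pos x y : d x y = 0%R -> x = y.
Proof. by move=> /agree_dist_eq0 /coords_inj. Qed.
Let d_sym x y : d x y = d y x. Proof. exact: agree_distC. Qed.
Let d_triangle y x z : (d x z <= d x y + d y z)%R.
Proof. exact: agree_dist_triangle. Qed.

HB.instance Definition _ := isMetric.Build R X dxx d_pos d_sym d_triangle.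

Lemma ball_agree (x y : X) n :
  ball x (n.+1%:R^-1 : R)%R y <-> agree n.+1 (coords x) (coords y).
Proof. by rewrite ballEmdist /=; exact: agree_dist_lt. Qed.

Lemma baire_nbhsP (x : X) U :
  nbhs x U <-> exists n, forall y : X, agree n (coords x) (coords y) -> U y.
Proof.
rewrite -nbhs_ballE; split=> [[e /= e0 eU]|[n nU]]; last first.
  exists (n.+1%:R^-1)%R; first by rewrite /= invr_gt0 ltr0n.
  by move=> y /ball_agree xy; apply: nU; exact: agree_le xy.
exists (Num.truncn e^-1).+1 => y xy; apply: eU.
apply: le_ball (proj2 (ball_agree x y _) xy).
rewrite -[leRHS]invrK lef_pV2 ?posrE ?ltr0n ?invr_gt0 //.
by apply: ltW; exact: truncnS_gt.
Qed.

Lemma baire_open_eq i m : open [set x : X | coords x i = m].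
Proof.
rewrite openE => x /= xi; apply/baire_nbhsP; exists (pickle i).+1 => y xy /=.
by rewrite -xi xy.
Qed.

Definition cylinder (l : seq (I * nat)) : set X :=
  [set x | forall p, p \in l -> coords x p.1 = p.2].

Definition prefix_conditions (n : nat) (x : I -> nat) : seq (I * nat) :=
  pmap (fun k => omap (fun i => (i, x i)) (@pickle_inv I k)) (iota 0 n).

Lemma cylinder_prefix n x (y : X) :
  cylinder (prefix_conditions n x) y <-> agree n x (coords y).
Proof.
rewrite /cylinder /= /prefix_conditions; split=> [h i ilt|xy [i m]].
  apply/esym/(h (i, x i)); rewrite mem_pmap; apply/mapP; exists (pickle i).
    by rewrite mem_iota.
  by rewrite pickleK_inv.
rewrite mem_pmap => /mapP[k]; rewrite mem_iota /= => kn.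
case E : (@pickle_inv I k) => [j|//] /= [-> ->]; apply/esym/xy.
by have := @pickle_invK I k; rewrite E /= => ->.
Qed.

(** Lists of conditions form a countable type, so the union is countable; both separability and the
    coding of open sets rest on this. *)
Lemma open_cylinders (U : set X) : open U ->
  U = \bigcup_(l in [set l | cylinder l `<=` U]) cylinder l.
Proof.
rewrite openE => oU; apply/seteqP; split=> [x Ux|x [l lU /lU]//].
have [n nU] := (baire_nbhsP x U).1 (oU x Ux).
exists (prefix_conditions n (coords x)); last by apply/cylinder_prefix.
by move=> y /cylinder_prefix /nU.
Qed.

Lemma baire_separable : separable_space X.
Proof.
pose D (l : seq (I * nat)) : set X :=
  if pselect (exists x : X, cylinder l x) is left e then [set sval (cid e)]
  else set0.
exists (\bigcup_l D l).
  apply: bigcup_countable => //= l _; rewrite /D.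
  by case: pselect => // e; apply: finite_set_countable.
move=> U [x Ux] oU.
have [l /= lU lx] : (\bigcup_(l in [set l | cylinder l `<=` U]) cylinder l) x.
  by rewrite -(open_cylinders oU).
have : exists y, D l y /\ cylinder l y.
  rewrite /D; case: pselect => [e|[]]; last by exists x.
  by exists (sval (cid e)); split => //; exact: svalP.
by move=> [y [Dy ly]]; exists y; split; [exact: lU|exists l].
Qed.

Hypothesis P_closed : forall z,
  (forall n, exists2 x, P x & agree n x z) -> P z.

Lemma baire_complete : complete_space X.
Proof.
move=> F FF /cauchyP Fc.
have Fc' n : exists x : X, F [set y | agree n (coords x) (coords y)].
  have [|x Fx] := Fc (n.+1%:R^-1)%R; first by rewrite invr_gt0 ltr0n.
  exists x; apply: filterS Fx => y /ball_agree; exact: agree_le.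
have [x Fx] := choice Fc'.
(* The diagonal limit: [(pickle i).+1] is the first stage at which coordinate [i] is settled. *)
pose z i := coords (x (pickle i).+1) i.
have zx n : agree n (coords (x n)) z.
  move=> i ilt.
  have [y [ny iy]] := filter_ex (filterI (Fx n) (Fx (pickle i).+1)).
  by rewrite /z iy // ny.
have Pz : P z by apply: P_closed => n; exists (coords (x n)) => //; exact: coordsP.
exists (BaireSub R z Pz) => U /baire_nbhsP [n nU].
apply: filterS (Fx n) => y xy; apply: nU.
by apply: agree_trans xy; apply: agree_sym; exact: zx.
Qed.

Lemma baire_polish : polish_space R X.
Proof.
split; first exact: baire_separable.
exists X; first exact: baire_complete.
by exists id, id; split => // x; exact: cvg_id.
Qed.

End baire_sub.

Lemma baire_continuous (R : realType) (I J : countType) (P : set (I -> nat))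
    (Q : set (J -> nat)) (f : baire_sub R P -> baire_sub R Q) :
  (forall j, exists i, forall x, coords (f x) j = coords x i) -> continuous f.
Proof.
move=> /choice[g fE] x U /baire_nbhsP [n nU]; apply/baire_nbhsP.
exists (\max_(j <- pmap (@pickle_inv J) (iota 0 n)) (pickle (g j)).+1) => y xy.
apply: nU => j jn; rewrite !fE; apply: xy.
apply: (@leq_bigmax_seq _ (pmap (@pickle_inv J) (iota 0 n)) (fun=> true)
  (fun j => (pickle (g j)).+1) j) => //.
by rewrite mem_pmap; apply/mapP; exists (pickle j); rewrite ?mem_iota ?pickleK_inv.
Qed.

(** * The self-referential tree *)

(** The three summands index the entries of [r] at nodes, the terms of [y] and the terms of [N]. *)
Definition bcoord : Type := (seq nat + (nat + nat))%type.
HB.instance Definition _ := Countable.on bcoord.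

Definition bpoint := bcoord -> nat.

Definition bcode (x : bpoint) (s : seq nat) : nat := x (inl s).
Definition elt (x : bpoint) (n : nat) : nat := x (inr (inl n)).
Definition len (x : bpoint) (n : nat) : nat := x (inr (inr n)).

Definition advance (x : bpoint) : bpoint := fun i =>
  match i with
  | inl s => x (inl s)
  | inr (inl n) => x (inr (inl n.+1))
  | inr (inr n) => x (inr (inr n.+1))
  end.

(** The basic clopen sets fixing one coordinate, numbered by pairs of a coordinate and a value;
    other numbers give the empty set. *)
Definition leaf (k : nat) (x : bpoint) : bool :=
  if unpickle k is Some (i, m) then x (i : bcoord) == (m : nat) else false.

(* [v s] is [0] when [x] is outside the set coded by [r] at [s]; otherwise it
   is [m.+1], where [m] is a child of [s] at which [x] is outside. *)
Definition consistent (r : seq nat -> nat) (x : bpoint) (v : seq nat -> nat)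
    (s : seq nat) (m : nat) : Prop :=
  if r s is k.+1 then (v s != 0) = leaf k x
  else (v s = m.+1 -> v (rcons s m) = 0) /\ (v s = 0 -> v (rcons s m) != 0).

(** A branch of the tree lists a point [x], two valuations of nodes ([false] for [x], [true] for
    [advance x]) and a sequence whose entry at 0 selects the kind of refutation and whose other
    entries form a path. *)
Definition wcoord : Type := (bcoord + ((bool * seq nat) + nat))%type.
HB.instance Definition _ := Countable.on wcoord.

(* An opaque numbering, so that unification never computes with it. *)
Lemma wcode_subproof : {f : wcoord -> nat & {g | pcancel f g}}.
Proof. by exists pickle, unpickle; exact: pickleK. Qed.

Definition wcode : wcoord -> nat := projT1 wcode_subproof.
Definition wdecode : nat -> option wcoord := sval (projT2 wcode_subproof).

Lemma wcodeK : pcancel wcode wdecode.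
Proof. exact: svalP (projT2 wcode_subproof). Qed.

Definition wpoint (g : nat -> nat) : bpoint :=
  fun i => g (wcode (inl i)).
Definition wval (g : nat -> nat) (b : bool) (s : seq nat) : nat :=
  g (wcode (inr (inl (b, s)))).
Definition wpath (g : nat -> nat) (n : nat) : nat :=
  g (wcode (inr (inr n))).

Definition dominated (t : seq nat) (y : nat -> nat) :=
  forall i, i < size t -> nth 0 t i <= y i.

Definition extends (t : seq nat) (g : nat -> nat) :=
  forall i, i < size t -> g i = nth 0 t i.

Definition code_index (s : seq nat) : nat := wcode (inl (inl s)).

Definition code_agree (r : seq nat -> nat) (t : seq nat) :=
  forall s, code_index s < size t -> nth 0 t (code_index s) = r s.

Section conditions.
Variable U : seq nat -> Prop.

(** [U] stands for the set of admissible nodes, still to be defined; the recursion will put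
    approximations in its place. *)
Definition tree (r : seq nat -> nat) (t : seq nat) := code_agree r t /\ U t.

Definition dominates (r : seq nat -> nat) (y : nat -> nat) (N : nat) :=
  exists t, [/\ size t = N, tree r t & dominated t y].

Definition least_len (r : seq nat -> nat) (y : nat -> nat) (N : nat) :=
  ~ dominates r y N /\ forall M, M < N -> dominates r y M.

(** The code is ill-founded: the path meets no leaf from length [wpath g 0] on. In [condition] this
    length is positive, which spares the root, where [r] holds the number of coded sets. *)
Definition path_condition (g : nat -> nat) := forall m, wpath g 0 <= m ->
  bcode (wpoint g) (mkseq (fun i => wpath g i.+1) m) = 0.

(** The two valuations certify that [x] and [advance x] lie in the same coded sets, the set of index
    [i] being coded at [[:: i]]; so these sets cannot be the classes of a coloring. *)
Definition point_condition (n : nat) (g : nat -> nat) :=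
  let x := wpoint g in
  [/\ forall j, elt x j < elt x j.+1,
      forall j, len x j < n ->
        least_len (bcode x) (fun i => elt x (j + i)) (len x j),
      forall b s m, s != [::] ->
        consistent (bcode x) (if b then advance x else x) (wval g b) s m
    & forall i, i < bcode x [::] ->
        (wval g false [:: i] == 0) = (wval g true [:: i] == 0)].

Definition condition (n : nat) (g : nat -> nat) :=
  if wpath g 0 is 0 then point_condition n g else path_condition g.

End conditions.

Lemma condition_le U m n g : m <= n -> condition U n g -> condition U m g.
Proof.
rewrite /condition; case: (wpath g 0) => // mn [? h ? ?]; split => // j jm.
by apply: h; exact: leq_trans mn.
Qed.

Lemma least_len_local (U V : seq nat -> Prop) r r' y y' N :
  (forall t, size t <= N -> U t <-> V t) ->
  (forall s, code_index s < N -> r s = r' s) ->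
  (forall i, i < N -> y i = y' i) ->
  least_len U r y N -> least_len V r' y' N.
Proof.
move=> UV rr yy.
have domE M : M <= N -> dominates U r y M <-> dominates V r' y' M.
  move=> MN; split=> -[t [tM [tr Ut] ty]]; exists t; split => //; try split.
  - by move=> s st; rewrite -rr; [exact: tr|lia].
  - by apply/UV => //; lia.
  - by move=> i it; rewrite -yy; [exact: ty|lia].
  - by move=> s st; rewrite rr; [exact: tr|lia].
  - by apply/UV => //; lia.
  - by move=> i it; rewrite yy; [exact: ty|lia].
move=> [nN domM]; split=> [/(domE _ (leqnn N)) //|M MN].
by apply/domE; [exact: ltnW|exact: domM].
Qed.

(** The clause on a length [len x j < n] consults nodes of at most that length, hence shorter than
    [n]. This makes the recursion below well founded. *)
Lemma condition_ext (U V : seq nat -> Prop) n g :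
  (forall t, size t < n -> U t <-> V t) -> condition U n g -> condition V n g.
Proof.
rewrite /condition; case: (wpath g 0) => // UV [? h ? ?]; split => // j jm.
by apply: least_len_local (h j jm) => // t tl; apply: UV; lia.
Qed.

(** Recursion on the length of [t], with fuel as structural argument; any fuel above the length
    gives the same predicate. *)
Fixpoint admissible_fuel (k : nat) (t : seq nat) : Prop :=
  if k is k'.+1 then
    exists2 g, extends t g & condition (admissible_fuel k') (size t) g
  else False.

Definition admissible (t : seq nat) := admissible_fuel (size t).+1 t.

Lemma admissible_fuelE k t : size t < k -> admissible_fuel k t <-> admissible t.
Proof.
elim/ltn_ind: k t => -[//|k] IH t tk; rewrite /admissible /=.
suff UV u : size u < size t ->
    admissible_fuel k u <-> admissible_fuel (size t) u.
  by split=> -[g tg c]; exists g => //; apply: condition_ext c => u /UV ->.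
by move=> ut; rewrite !IH //; lia.
Qed.

Lemma admissibleE t :
  admissible t <-> exists2 g, extends t g & condition admissible (size t) g.
Proof.
rewrite {1}/admissible /=.
by split=> -[g tg c]; exists g => //; apply: condition_ext c => u ut;
  rewrite admissible_fuelE.
Qed.

(** * Branches of the tree are refutations *)

Notation atree := (tree admissible).

(* [g] witnesses that the Borel code [r] is ill-founded, or does not define a
   coloring at some bpoint of the fibre over [r]. *)
Definition refutes (r : seq nat -> nat) (g : nat -> nat) :=
  (forall s, bcode (wpoint g) s = r s) /\ forall n, condition admissible n g.

Lemma refutes_tree r g n : refutes r g -> atree r (mkseq g n).
Proof.
move=> [gr gc]; split=> [s|].
  by rewrite size_mkseq => sn; rewrite nth_mkseq // -gr.
apply/admissibleE; exists g; last exact: gc.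
by move=> i; rewrite size_mkseq => iltn; rewrite nth_mkseq.
Qed.

Lemma atree_take r t n : atree r t -> atree r (take n t).
Proof.
move=> [tr /admissibleE [g tg c]]; split.
  by move=> s; rewrite size_take_min leq_min => /andP[sn st]; rewrite nth_take ?tr.
apply/admissibleE; exists g.
  by move=> i; rewrite size_take_min leq_min => /andP[sn st]; rewrite nth_take ?tg.
by apply: condition_le c; rewrite size_take_min geq_minr.
Qed.

(** Each single clause of [condition] reads finitely many entries of [g]. A long enough node has an
    extension [h] that satisfies the clause and agrees with [g] at those entries. *)
Lemma tree_refutes r g : (forall n, atree r (mkseq g n)) -> refutes r g.
Proof.
move=> T.
have gr s : bcode (wpoint g) s = r s.
  have [h _] := T (code_index s).+1.
  by rewrite -h ?size_mkseq // nth_mkseq.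
split => // n0.
have approx (ks : seq wcoord) n : exists2 h,
    condition admissible n h & forall k, k \in ks -> h (wcode k) = g (wcode k).
  pose N := maxn n (\max_(k <- ks) (wcode k).+1).
  have [_ /admissibleE [h gh c]] := T N; rewrite size_mkseq in c.
  exists h; first by apply: condition_le c; exact: leq_maxl.
  move=> k kks.
  have kN : wcode k < N.
    rewrite /N leq_max; apply/orP; right.
    exact: (@leq_bigmax_seq _ ks (fun=> true) (fun k => (wcode k).+1) k).
  by rewrite gh ?size_mkseq // nth_mkseq.
pose tag : wcoord := inr (inr 0).
pose pc i : wcoord := inl i.
pose vc b s : wcoord := inr (inl (b, s)).
rewrite /condition; case E : (wpath g 0) => [|p]; last first.
  move=> m pm.
  pose s := mkseq (fun i => wpath g i.+1) m.
  have [h c hg] := approx (tag :: pc (inl s) ::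
    [seq (inr (inr i.+1) : wcoord) | i <- iota 0 m]) 0.
  have hE k : k \in [:: tag; pc (inl s)] -> h (wcode k) = g (wcode k).
    by move=> ks; apply: hg; move: ks; rewrite !inE => /orP[->|->] //; rewrite ?orbT.
  move: c; rewrite /condition /wpath -/tag hE ?mem_head // -[g _]/(wpath g 0) E.
  rewrite /path_condition /wpath -/tag hE ?mem_head // => /(_ m pm).
  have -> : mkseq (fun i => wpath h i.+1) m = s.
    apply/eq_in_map => i im; apply: hg; rewrite 2!in_cons; apply/orP; right.
    by apply/orP; right; apply/mapP; exists i.
  by rewrite /bcode /wpoint -/(pc (inl s)) hE ?inE ?eqxx ?orbT.
have approx' (ks : seq wcoord) n : exists2 h, point_condition admissible n h &
    forall k, k \in ks -> h (wcode k) = g (wcode k).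
  have [h c hg] := approx (tag :: ks) n; exists h; last first.
    by move=> k kks; apply: hg; rewrite inE kks orbT.
  by move: c; rewrite /condition /wpath -/tag hg ?mem_head // -[g _]/(wpath g 0) E.
split=> [j|j jn|b s m s0|i].
- have [h [c _ _ _] hg] := approx' [:: pc (inr (inl j)); pc (inr (inl j.+1))] 0.
  have := c j; rewrite /elt /wpoint -!/(pc _) !hg //; by rewrite !inE eqxx ?orbT.
- set x := wpoint g; set N := len x j.
  (* The entries read by [least_len] at length [N]: the length itself, [N] terms of the sequence,
     and code entries of index below [N]. The bound [N.+1] below makes the clause apply to length
     [N]. *)
  pose ks := pc (inr (inr j)) ::
    ([seq pc (inr (inl (j + i))) | i <- iota 0 N] ++
     pmap (wdecode) (iota 0 N)).
  have [h [_ c _ _] hg] := approx' ks N.+1.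
  have lenE : len (wpoint h) j = N by apply: hg; rewrite mem_head.
  have := c j; rewrite lenE => /(_ (leqnn _)); apply: least_len_local => //.
    move=> s sN; rewrite /bcode /wpoint; apply: hg.
    rewrite !inE mem_cat mem_pmap; apply/orP; right; apply/orP; right.
    apply/mapP; exists (code_index s); first by rewrite mem_iota.
    by rewrite /code_index wcodeK.
  move=> i iN; rewrite /elt /wpoint; apply: hg.
  rewrite !inE mem_cat; apply/orP; right; apply/orP; left.
  by apply/mapP; exists i => //; rewrite mem_iota.
(* When [s] is a leaf, its truth value reads coordinate [i] of [x], or for [advance x] the
   coordinate that is moved to [i]. *)
- pose lc : seq wcoord := if bcode (wpoint g) s is k.+1 then
    if (unpickle k : option (bcoord * nat)) is Some (i, m) then [:: pc i; pc (match i with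
      inl s => inl s | inr (inl n) => inr (inl n.+1)
      | inr (inr n) => inr (inr n.+1) end)] else [::] else [::].
  have [h [_ _ c _] hg] := approx' ([:: pc (inl s); vc b s; vc b (rcons s m)]
    ++ lc) 0.
  have := c b s m s0; rewrite /consistent.
  have -> : bcode (wpoint h) s = bcode (wpoint g) s by apply: hg; rewrite mem_head.
  have -> : wval h b s = wval g b s by apply: hg; rewrite !inE eqxx orbT.
  have -> : wval h b (rcons s m) = wval g b (rcons s m).
    by apply: hg; rewrite !inE eqxx !orbT.
  move: hg; rewrite /lc; case: (bcode (wpoint g) s) => // k.
  rewrite /leaf; case: (unpickle k) => // -[i l] hg ->; congr (_ == _).
  have h1 : wpoint h i = wpoint g i by apply: hg; rewrite !inE eqxx !orbT.
  case: b {c} hg => // hg; case: i h1 hg => [u|[n|n]] //= h1 hg; apply: hg;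
    by rewrite !inE eqxx !orbT.
- have [h [_ _ _ c] hg] :=
    approx' [:: pc (inl [::]); vc false [:: i]; vc true [:: i]] 0.
  have hE k : k \in [:: pc (inl [::]); vc false [:: i]; vc true [:: i]] ->
    h (wcode k) = g (wcode k) by exact: hg.
  have := c i; rewrite /wval /bcode /wpoint -!/(vc _ _) -!/(pc _) !hE //;
    by rewrite !inE eqxx ?orbT.
Qed.

(** König's lemma: the nodes below [y] form a finitely branching tree, and [big] selects those with
    arbitrarily long extensions. *)
Lemma dominates_refutes r y :
  (forall N, dominates admissible r y N) -> exists g, refutes r g.
Proof.
move=> D.
pose ok t := atree r t /\ dominated t y.
pose big s := forall N, exists t, [/\ N <= size t, size s <= size t,
  take (size s) t = s & ok t].
have big0 : big [::].
  by move=> N; have [t [tN tr ty]] := D N; exists t; rewrite tN take0; split.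
have bigS s : big s -> exists a, big (rcons s a).
  move=> bs; apply: contrapT => /forallNP nb.
  have /choice [F FP] (a : nat) : exists N, forall M, N <= M -> forall t, ok t ->
      size s < size t -> take (size s).+1 t = rcons s a -> size t < M.
    have /existsNP [N nN] := nb a; exists N => M NM t okt st tE.
    rewrite ltnNge; apply/negP => Mt; apply: nN; exists t.
    by split; rewrite ?size_rcons //; exact: leq_trans Mt.
  (* Entries after [s] are at most [y (size s)], so finitely many bounds [F a] would limit all
     extensions of [s]. *)
  pose M := maxn (size s).+1 (\max_(a < (y (size s)).+1) F a).
  have [t [Mt st tE okt]] := bs M.
  have slt : size s < size t by apply: leq_trans Mt; exact: leq_maxl.
  have ay : nth 0 t (size s) < (y (size s)).+1 by rewrite ltnS; exact: okt.2.
  have : size t < M; last by rewrite ltnNge Mt.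
  apply: (FP (nth 0 t (size s))) => //.
    rewrite leq_max; apply/orP; right.
    exact: (@leq_bigmax _ (fun a : 'I_(y (size s)).+1 => F a) (Ordinal ay)).
  by rewrite (take_nth 0 slt) tE.
pose S := {s | big s}.
have /choice [f fP] (s : S) : exists a, big (rcons (sval s) a).
  exact: bigS (svalP s).
pose next (s : S) : S := exist _ (rcons (sval s) (f s)) (fP s).
pose st n := iter n next (exist _ [::] big0).
have sizest n : size (sval (st n)) = n.
  by elim: n => // n IH; rewrite /= size_rcons IH.
pose g n := f (st n).
have stE n : sval (st n) = mkseq g n.
  by elim: n => // n IH; rewrite mkseqS -IH.
exists g; apply: tree_refutes => n.
have [t [_ nt tE [tr _]]] := svalP (st n) 0.
by rewrite -stE -tE; exact: atree_take.
Qed.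

Definition valid_point : set bpoint := [set x |
  (forall n, elt x n < elt x n.+1) /\
  forall n, least_len admissible (bcode x) (fun i => elt x (n + i)) (len x n)].

(** This is why the lengths belong to the point: once the length is known, [least_len] reads only
    finitely many coordinates. *)
Lemma valid_point_closed z :
  (forall n, exists2 x, valid_point x & agree n x z) -> valid_point z.
Proof.
move=> H.
have approx (ks : seq bcoord) : exists2 x, valid_point x &
    forall k, k \in ks -> x k = z k.
  have [x Vx xz] := H (\max_(k <- ks) (pickle k).+1); exists x => // k kks.
  by apply: xz; exact: (@leq_bigmax_seq _ ks (fun=> true) (fun k => (pickle k).+1) k).
split=> n.
  have [x [c _] xz] := approx [:: inr (inl n); inr (inl n.+1)].
  have := c n; rewrite /elt !xz //; by rewrite !inE eqxx ?orbT.
set N := len z n.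
have [x [_ c] xz] := approx (inr (inr n) :: [seq inr (inl (n + i)) | i <- iota 0 N] ++
  pmap (fun k => if wdecode k is Some (inl i) then Some i else None)
    (iota 0 N)).
have := c n; have -> : len x n = N by apply: xz; rewrite mem_head.
apply: least_len_local => //.
  move=> s sN; rewrite /bcode; apply: xz.
  rewrite !inE mem_cat mem_pmap; apply/orP; right; apply/orP; right.
  apply/mapP; exists (code_index s); first by rewrite mem_iota.
  by rewrite /code_index wcodeK.
move=> i iN; rewrite /elt; apply: xz.
rewrite !inE mem_cat; apply/orP; right; apply/orP; left.
by apply/mapP; exists i => //; rewrite mem_iota.
Qed.

Lemma valid_advance x : valid_point x -> valid_point (advance x).
Proof.
move=> [xS xl]; split=> n; first exact: xS.
apply: least_len_local (xl n.+1) => //.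
Qed.

Lemma least_len_unique U r y M N :
  least_len U r y M -> least_len U r y N -> M = N.
Proof.
move=> [nM domM] [nN domN]; have [lt|lt|//] := ltngtP M N.
  by case: nM; exact: domN.
by case: nN; exact: domM.
Qed.

(** The lengths, being least, are determined by the code and the sequence. *)
Lemma valid_point_eq x x' : valid_point x -> valid_point x' ->
  bcode x =1 bcode x' -> elt x =1 elt x' -> x = x'.
Proof.
move=> [_ xl] [_ xl'] cE eE; apply/funext => -[s|[n|n]].
- exact: cE.
- exact: eE.
apply: least_len_unique (xl' n); apply: least_len_local (xl n) => // i _.
Qed.

(** * Codes for Borel sets *)

(** Countable unions of complements, iterated from the clopen sets [leaf], give all Borel sets;
    induction on codes replaces induction on Borel rank. *)
Inductive borel_code := Leaf of nat | Nor of (nat -> borel_code).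

Fixpoint bmem (B : borel_code) (x : bpoint) : Prop :=
  match B with
  | Leaf k => leaf k x
  | Nor g => exists m, ~ bmem (g m) x
  end.

Fixpoint codes (r : seq nat -> nat) (B : borel_code) (s : seq nat) : Prop :=
  match B with
  | Leaf k => r s = k.+1
  | Nor g => r s = 0 /\ forall m, codes r (g m) (rcons s m)
  end.

Lemma codes_inj r B B' s : codes r B s -> codes r B' s -> B = B'.
Proof.
elim: B B' s => [k|g IH] [k'|g'] s /=.
- by move=> -> [->].
- by move=> -> [].
- by move=> [->].
move=> [_ gc] [_ gc']; congr Nor; apply/funext => m.
by apply: IH (gc m) (gc' m).
Qed.

(** On a well-founded code the local rules fix, from the leaves upwards, where the valuation
    vanishes. *)
Lemma codes_consistent r B s x v : codes r B s -> s != [::] ->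
  (forall u m, u != [::] -> consistent r x v u m) -> v s != 0 <-> bmem B x.
Proof.
move=> + + cons; elim: B s => [k|g IH] s /=.
  by move=> rs s0; have := cons s 0 s0; rewrite /consistent rs => ->.
move=> [rs gc] s0.
have rcons0 m : rcons s m != [::] by case: (s).
have {}IH m : v (rcons s m) != 0 <-> bmem (g m) x by exact: IH.
split=> [|[m nm]].
  case vs : (v s) => [//|m] _; exists m => /IH.
  by have := cons s m s0; rewrite /consistent rs => -[/(_ vs) ->].
apply/eqP => vs; apply: nm; apply/IH.
by have := cons s m s0; rewrite /consistent rs => -[_]; apply.
Qed.

Lemma codes_path r B p n : codes r B (mkseq p n) ->
  exists2 m, n <= m & r (mkseq p m) != 0.
Proof.
elim: B n => [k|g IH] n /=; first by move=> rn; exists n; rewrite ?rn.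
move=> [_ /(_ (p n))]; rewrite -mkseqS => /IH[m nm rm].
by exists m => //; exact: ltnW.
Qed.

(** A node that codes nothing has entry 0 and a child that codes nothing; dependent choice yields a
    path of such nodes, which never meets a leaf. *)
Lemma codes_exist r :
  (forall p n, 0 < n -> exists2 m, n <= m & r (mkseq p m) != 0) ->
  forall s, s != [::] -> exists B, codes r B s.
Proof.
move=> wf s s0; apply: contrapT => nB.
pose S := {u : seq nat | ~ exists B, codes r B u}.
have next (u : S) : exists m, ~ exists B, codes r B (rcons (sval u) m).
  case: u => u nu /=; apply: contrapT => /forallNP h; apply: nu.
  have {}h m : exists B, codes r B (rcons u m) by apply: contrapT; exact: h.
  case ru : (r u) => [|k]; last by exists (Leaf k).
  by have [g gP] := choice h; exists (Nor g).
have [f fP] := choice next.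
pose st n := iter n (fun u : S => exist _ (rcons (sval u) (f u)) (fP u) : S)
  (exist _ s nB).
pose p i := if i < size s then nth 0 s i else f (st (i - size s)).
have stE n : sval (st n) = mkseq p (size s + n).
  elim: n => [|n IH]; last first.
    by rewrite addnS mkseqS -IH /= /p ltnNge leq_addr /= addKn.
  rewrite addn0; apply: (@eq_from_nth _ 0); rewrite ?size_mkseq //= => i ilt.
  by rewrite nth_mkseq // /p ilt.
have [|m sm rm] := wf p (size s); first by rewrite lt0n size_eq0.
have := svalP (st (m - size s)); rewrite stE subnKC //; apply.
move: rm; case rm : (r (mkseq p m)) => [//|k] _; by exists (Leaf k).
Qed.

(** Nodes beyond a leaf repeat its value, so that every node codes some set. *)
Fixpoint flat (B : borel_code) (u : seq nat) : nat :=
  match B, u with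
  | Leaf k, _ => k.+1
  | Nor _, [::] => 0
  | Nor g, m :: u' => flat (g m) u'
  end.

Lemma flat_codes r B s : (forall u, r (s ++ u) = flat B u) -> codes r B s.
Proof.
elim: B s => [k|g IH] s /= rE; first by rewrite -[s]cats0 rE.
split=> [|m]; first by rewrite -[s]cats0 rE.
by apply: IH => u; rewrite cat_rcons rE.
Qed.

Lemma flat_cat B u : exists B', forall w, flat B (u ++ w) = flat B' w.
Proof.
elim: u B => [|m u IH] B; first by exists B.
case: B => [k|g]; first by exists (Leaf k).
by have [B' B'E] := IH (g m); exists B'.
Qed.

Definition assemble (x : bpoint) (v : bool -> seq nat -> nat) (q : nat -> nat) :
    nat -> nat := fun k =>
  match wdecode k with
  | Some (inl i) => x i
  | Some (inr (inl (b, s))) => v b s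
  | Some (inr (inr n)) => q n
  | None => 0
  end.

Lemma assemble_point x v q : wpoint (assemble x v q) = x.
Proof. by apply/funext => i; rewrite /wpoint /assemble wcodeK. Qed.

Lemma assemble_val x v q b s : wval (assemble x v q) b s = v b s.
Proof. by rewrite /wval /assemble wcodeK. Qed.

Lemma assemble_path x v q n : wpath (assemble x v q) n = q n.
Proof. by rewrite /wpath /assemble wcodeK. Qed.

(** * Every code is refuted *)

Section unrefuted.
Variable r : seq nat -> nat.
Hypothesis r_ok : forall g, ~ refutes r g.

Let wf p n : 0 < n -> exists2 m, n <= m & r (mkseq p m) != 0.
Proof.
move=> n0; apply: contrapT => /forall2NP h.
(* The entry [n] at 0 is positive and so selects [path_condition]. *)
pose g := assemble (fun i => if i is inl s then r s else 0) (fun _ _ => 0)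
  (fun i => if i is i'.+1 then p i' else n).
apply: (r_ok (g := g)); split=> [s|k]; first by rewrite /bcode assemble_point.
rewrite /condition assemble_path; case: n n0 h @g => // n _ h g m.
rewrite assemble_path => nm; rewrite /bcode assemble_point.
have -> : mkseq (fun i => wpath g i.+1) m = mkseq p m.
  by apply: eq_mkseq => i; rewrite assemble_path.
by apply/eqP; have [|/negP] := h m; [rewrite nm|rewrite negbK].
Qed.

Let least_lenE y : exists N, least_len admissible r y N.
Proof.
have exN : exists N, `[< ~ dominates admissible r y N >].
  apply: contrapT => /forallNP h.
  have [|g rg] := @dominates_refutes r y; last exact: r_ok rg.
  by move=> N; apply: contrapT => nd; apply: (h N); apply/asboolP.
case: (ex_minnP exN) => N /asboolP nN Nmin; exists N; split => // M MN.
apply: contrapT => nM; have := Nmin M; rewrite leqNgt MN => /(_ _)/negP; apply=> //.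
exact/asboolP.
Qed.

(** Without refutations all lengths exist, so [pt] sends each infinite set to a point of the fibre
    over [r], continuously and turning the shift into [advance]. The coded sets pull back to
    completely Ramsey families, and an infinite set homogeneous for finitely many of them lies in
    the same ones as its shift: this is a refutation. *)
Lemma unrefuted_absurd : False.
Proof.
have [L LP] := choice least_lenE.
pose pt (Y : set nat) : bpoint := fun i => match i with
  | inl s => r s
  | inr (inl n) => enumerate Y n
  | inr (inr n) => L (fun i => enumerate Y (n + i))
  end.
have pt_valid Y : unbounded Y -> valid_point (pt Y).
  by move=> uY; split=> n; [exact: enumerate_lt|exact: LP].
have advance_pt Y : advance (pt Y) = pt (remove_min Y).
  apply/funext => -[s|[n|n]] //=; first by rewrite enumerate_remove_min.
  by congr L; apply/funext => i; rewrite enumerate_remove_min.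
(* Continuity of [pt]; a length [N] at index [n] depends only on the terms of index below [n + N],
   by [least_len_local]. *)
have pt_local i Y : unbounded Y -> exists a, forall Y', unbounded Y' ->
    below a Y' = below a Y -> pt Y' i = pt Y i.
  move=> uY; case: i => [s|[n|n]]; first by exists 0.
    have [a aP] := enumerate_local n uY.
    by exists a => Y' uY' YY'; exact: aP.
  have [a aP] := enumerate_local (n + pt Y (inr (inr n))) uY.
  exists a => Y' uY' YY'; apply: (@least_len_unique admissible r
    (fun i => enumerate Y' (n + i))); first exact: LP.
  apply: least_len_local (LP (fun i => enumerate Y (n + i))) => // i iN.
  by rewrite (aP Y') //= leq_add2l ltnW.
have RB B : completely_ramsey [set Y | bmem B (pt Y)].
  elim: B => [k|g IH].
    apply: completely_ramsey_open => Y uY /=; rewrite /leaf.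
    case: unpickle => // -[i m]; have [a aP] := pt_local i Y uY.
    by exists a => Y' uY' YY'; rewrite aP.
  suff -> : [set Y | bmem (Nor g) (pt Y)] =
      \bigcup_m ~` [set Y | bmem (g m) (pt Y)].
    by apply: completely_ramsey_bigcup => m; exact: completely_ramsey_setC.
  by apply/seteqP; split=> Y [m]; [exists m|move=> _ h; exists m].
have /choice[BB BBP] : forall s, exists B, s != [::] -> codes r B s.
  move=> [|i s]; first by exists (Leaf 0).
  by have [B] := codes_exist wf (isT : i :: s != [::]); exists B.
(* The valuation chooses a witnessing child at each [Nor] node whose set contains [x]; at a leaf, 1
   is just a nonzero value. *)
have val_ex (x : bpoint) (s : seq nat) : exists n, s != [::] ->
    (n != 0 <-> bmem (BB s) x) /\
    (forall m, n = m.+1 -> r s = 0 -> ~ bmem (BB (rcons s m)) x).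
  case: (eqVneq s [::]) => [|s0]; first by exists 0.
  have [xs|nxs] := pselect (bmem (BB s) x); last by exists 0.
  have := BBP s s0; case: (BB s) xs => [k|g] /= xs.
    by move=> rs; exists 1 => _; split => //; rewrite rs.
  move=> [rs gc]; case: xs => m nm; exists m.+1 => _; split.
    by split => // _; exists m.
  move=> _ [<-] _; rewrite (codes_inj (BBP _ _) (gc m)) //.
  by case: (s).
have [v vP] : exists v : bpoint -> seq nat -> nat, forall x s, s != [::] ->
    (v x s != 0 <-> bmem (BB s) x) /\
    (forall m, v x s = m.+1 -> r s = 0 -> ~ bmem (BB (rcons s m)) x).
  have /choice[v vP] : forall x, exists w : seq nat -> nat, forall s, s != [::] ->
    (w s != 0 <-> bmem (BB s) x) /\
    (forall m, w s = m.+1 -> r s = 0 -> ~ bmem (BB (rcons s m)) x).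
    by move=> x; have /choice[w wP] := val_ex x; exists w.
  by exists v.
have v_cons x s m : s != [::] -> consistent r x (v x) s m.
  move=> s0; rewrite /consistent.
  have [vs vm] := vP x s s0.
  have rcons0 : rcons s m != [::] by case: (s).
  have [vr _] := vP x _ rcons0.
  have := BBP s s0; case rs : (r s) => [|k].
    case E : (BB s) => [k|g] /=; first by rewrite rs.
    move=> [_ gc].
    have gE : BB (rcons s m) = g m by apply: codes_inj (BBP _ _) (gc m).
    rewrite gE in vr; rewrite E /= in vs; split=> [vsm|vs0].
      apply/eqP/negPn/negP => /vr; rewrite -gE; exact: vm.
    apply/vr; apply: contrapT => nm.
    by have : v x s != 0; [apply/vs; exists m|rewrite vs0].
  case E : (BB s) => [k'|g] /=; last by rewrite rs => -[].
  rewrite rs => -[->]; rewrite E /= in vs.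
  by apply/idP/idP => /vs.
pose P i := [set Y | bmem (BB [:: i]) (pt Y)].
have [|Z [_ uZ hZ]] := @ramsey_sequence P setT _ unboundedT.
  by move=> n; apply/completely_ramsey_ramsey/RB.
have [a aP] := choice hZ.
(* Only [r [::]] sets matter, so one bound serves them all. *)
pose b := \max_(i < r [::]) a i.
pose Y := above b Z.
have uY : unbounded Y by exact: unbounded_above.
have rootE i : i < r [::] -> P i Y <-> P i (remove_min Y).
  move=> ir; have ab : a i <= b.
    exact: (@leq_bigmax _ (fun i : 'I_(r [::]) => a i) (Ordinal ir)).
  have YZ : Y `<=` above (a i) Z by exact: above_mono.
  have YZ' : remove_min Y `<=` above (a i) Z by move=> n [/YZ].
  have uY' := unbounded_remove_min uY.
  by case: (aP i) => h; split => Pi //; [exact: h|exact: h| |];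
    exfalso; move: Pi; apply: h.
pose w (c : bool) := v (if c then advance (pt Y) else pt Y).
apply: (r_ok (g := assemble (pt Y) w (fun=> 0))).
split=> [s|n]; first by rewrite /bcode assemble_point.
rewrite /condition assemble_path /point_condition assemble_point.
have [ptS ptL] := pt_valid Y uY.
split=> [//|j _|c s m s0|i ir]; first exact: ptL.
  rewrite /consistent; have := v_cons (if c then advance (pt Y) else pt Y) s m s0.
  by rewrite /consistent !assemble_val.
rewrite !assemble_val /w advance_pt.
have [v0 _] := vP (pt Y) [:: i] isT.
have [v1 _] := vP (pt (remove_min Y)) [:: i] isT.
apply: negb_inj; apply/idP/idP.
  by move=> /v0 h; apply/v1; apply/rootE.
by move=> /v1 h; apply/v0; apply/rootE.
Qed.

End unrefuted.

Lemma refutes_exists r : exists g, refutes r g.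
Proof. by apply: contrapT => /forallNP; exact: unrefuted_absurd. Qed.

Lemma continuous_borel_fun (S T : topologicalType) (f : S -> T) :
  continuous f -> borel_fun f.
Proof.
move=> /continuousP cf; apply: smallest_sub => [|O oO] /=; last first.
  by apply: sub_sigma_algebra; exact: cf.
split.
- by rewrite preimage_set0; exact: sigma_algebra0.
- move=> A hA; rewrite setTD preimage_setC -setTD; exact: sigma_algebraCD.
- by move=> A hA; rewrite preimage_bigcup; exact: sigma_algebra_bigcup.
Qed.

Lemma polish_borel_set1 (R : realType) (Y : topologicalType) (y : Y) :
  polish_space R Y -> borel_set [set y].
Proof.
move=> [_ [M _ [f [g [fK _ cf _]]]]].
rewrite -(setCK [set y]) -setTD; apply: sigma_algebraCD.
apply: sub_sigma_algebra.
have -> : ~` [set y] = f @^-1` (~` [set f y]).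
  by apply/seteqP; split=> z /= h e; apply: h; [exact: (can_inj fK)|rewrite e].
move/continuousP: cf; apply; rewrite openC.
exact: (accessible_closed_set1 (hausdorff_accessible (@metric_hausdorff R M))).
Qed.

(** * The Polish space and its map *)

Section space.
Variable R : realType.
Local Notation X := (baire_sub R valid_point).

Definition adv (x : X) : X := BaireSub R _ (valid_advance (coordsP x)).

Lemma adv_continuous : continuous adv.
Proof.
apply: baire_continuous => -[s|[n|n]].
- by exists (inl s).
- by exists (inr (inl n.+1)).
- by exists (inr (inr n.+1)).
Qed.

Lemma elt_adv_lt (x : X) : elt (coords x) 0 < elt (coords (adv x)) 0.
Proof. by have [+ _] := coordsP x; apply. Qed.

Lemma adv_neq (x : X) : x <> adv x.
Proof. by move=> e; have := elt_adv_lt x; rewrite -e ltnn. Qed.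

(** The image retains the code and all later terms, and the lengths are determined; only the first
    term is lost, and it is smaller than the first term of the image. *)
Lemma adv_finite_to_one : finite_to_one adv.
Proof.
move=> y.
pose k (x : X) := elt (coords x) 0.
have k_inj : {in adv @^-1` [set y] &, injective k}.
  move=> x x' /set_mem /= xy /set_mem /= xy' kx; apply: coords_inj.
  have E : coords (adv x) = coords (adv x') by rewrite xy xy'.
  apply: valid_point_eq; [exact: coordsP|exact: coordsP|move=> s|move=> [//|n]].
    exact: (congr1 (fun z : bpoint => z (inl s)) E).
  exact: (congr1 (fun z : bpoint => z (inr (inl n))) E).
rewrite -(eq_finite_set (inj_card_eq k_inj)).
apply: (@sub_finite_set _ _ `I_(k y)); last exact: finite_II.
by move=> _ [x /= <- <-]; exact: elt_adv_lt.
Qed.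

(** * Borel subsets of the space are coded *)

Definition coded (B : set X) :=
  exists C, forall x, B x <-> bmem C (coords x).

Lemma leaf_pickle (p : bcoord * nat) x : leaf (pickle p) x = (x p.1 == p.2).
Proof. by rewrite /leaf pickleK; case: p. Qed.

Lemma coded_bigcup (B : nat -> set X) :
  (forall n, coded (B n)) -> coded (\bigcup_n B n).
Proof.
(* A [Nor] of a constant family is a complement and cancels the one in the outer [Nor]. *)
move=> /choice[C CP]; exists (Nor (fun n => Nor (fun=> C n))) => x /=.
split=> [[n _ /CP h]|[n h]]; first by exists n => -[].
exists n => //; apply/CP; apply: contrapT => nC; apply: h; by exists 0.
Qed.

Lemma coded_setC (B : set X) : coded B -> coded (~` B).
Proof.
move=> [C CP]; exists (Nor (fun=> C)) => x /=.
by split=> [nB|[_ nC] /CP //]; exists 0 => /CP.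
Qed.

Lemma coded_set0 : coded set0.
Proof.
(* This leaf asks the second term of an increasing sequence to be 0. *)
exists (Leaf (pickle ((inr (inl 1), 0) : bcoord * nat))) => x /=.
rewrite leaf_pickle; split=> // /eqP /= h.
have [/(_ 0) + _] := coordsP x; rewrite /elt h; lia.
Qed.

Lemma coded_setI (A B : set X) : coded A -> coded B -> coded (A `&` B).
Proof.
move=> cA cB; rewrite -(setCK (A `&` B)) setCI.
have -> : ~` A `|` ~` B = \bigcup_n (if n is 0 then ~` A else ~` B).
  apply/seteqP; split=> [x [h|h]|x [[|n] _ h]]; by [exists 0|exists 1|left|right].
by apply/coded_setC/coded_bigcup => -[|n]; exact: coded_setC.
Qed.

Lemma coded_cylinder l : coded (@cylinder R bcoord valid_point l).
Proof.
elim: l => [|p l IH].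
  have -> : cylinder [::] = ~` (set0 : set X)
    by apply/seteqP; split=> x h; [case|move=> p].
  exact/coded_setC/coded_set0.
have -> : cylinder (p :: l) = [set x : X | coords x p.1 = p.2] `&` cylinder l.
  apply/seteqP; split=> x /= => [h|[hp hl] q].
    by split=> [|q ql]; apply: h; rewrite inE ?eqxx ?ql ?orbT.
  by rewrite inE => /orP[/eqP ->//|/hl].
apply: coded_setI => //; exists (Leaf (pickle p)) => x /=.
by rewrite leaf_pickle; split=> /eqP.
Qed.

Lemma coded_open (U : set X) : open U -> coded U.
Proof.
move=> oU; pose cyl : seq (bcoord * nat) -> set X := @cylinder R bcoord valid_point.
pose V n : set X := if unpickle n is Some l then
  if `[< cyl l `<=` U >] then cyl l else set0 else set0.
have UV : U = \bigcup_n V n.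
  rewrite {1}(open_cylinders oU); apply/seteqP; rewrite /V.
  split=> [x [l lU lx]|x [n _]].
    by exists (pickle l) => //; rewrite pickleK asboolT.
  by case: unpickle => // l; case: asboolP => // lU lx; exists l.
rewrite UV; apply: coded_bigcup => n; rewrite /V.
case: unpickle => [l|]; last exact: coded_set0.
by case: asboolP => _; [exact: coded_cylinder|exact: coded_set0].
Qed.

Lemma coded_borel (B : set X) : borel_set B -> coded B.
Proof.
move: B; apply: smallest_sub => [|O oO]; last exact: coded_open.
split; [exact: coded_set0| |exact: coded_bigcup].
by move=> A; rewrite setTD; exact: coded_setC.
Qed.

(** * The Borel chromatic number *)

(** Put codes of the color classes into one [r]. A refutation of [r] cannot be a path, as the codes
    are well founded; so it gives a point of the space with the same color as its image. *)
Lemma finite_coloring_absurd (Y : topologicalType) (c : X -> Y) :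
  polish_space R Y -> borel_coloring (function_graph adv) c ->
  ~ finite_set (range c).
Proof.
move=> pY [col bc] /finite_seqP[s cs].
pose B i : set Y := [set y | onth s i = Some y].
have /choice[C CP] i : coded (c @^-1` B i).
  apply: coded_borel; apply: bc.
  have -> : B i = if onth s i is Some a then [set a] else set0.
    by rewrite /B; case: onth => [a|]; apply/seteqP; split=> y //= [->].
  by case: onth => [a|]; [exact: polish_borel_set1 pY|exact: sigma_algebra0].
pose r (u : seq nat) := if u is i :: u' then flat (C i) u' else size s.
have r_codes u : u != [::] -> exists D, codes r D u.
  case: u => // i u _; have [D DE] := flat_cat (C i) u.
  by exists D; apply: flat_codes => w; rewrite /= DE.
have [g [gr gc]] := refutes_exists r.
have grE : bcode (wpoint g) = r by exact/funext.
have := gc 0; rewrite /condition; case E : (wpath g 0) => [|n].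
  move=> _.
  have gp n : point_condition admissible n g by have := gc n; rewrite /condition E.
  (* Since [g] meets the conditions for all [n], its point satisfies [least_len] at every index and
     so belongs to the space itself. *)
  have Vx : valid_point (wpoint g).
    split=> n; first by have [+ _ _ _] := gp 0; apply.
    by have [_ h _ _] := gp (len (wpoint g) n).+1; exact: h.
  pose x : X := BaireSub R _ Vx.
  have [_ _ cons roots] := gp 0.
  have : range c (c x) by exists x.
  rewrite cs /= => /onthP[i iE].
  have ir : i < r [::] by rewrite /= -onthTE iE.
  have memE (b : bool) : wval g b [:: i] != 0 <->
      bmem (C i) (if b then advance (wpoint g) else wpoint g).
    apply: (@codes_consistent r) => //.
      by apply: (@flat_codes r (C i) [:: i]) => u.
    by move=> u m u0; rewrite -grE; exact: cons.
  have xB : bmem (C i) (coords x) by apply/CP.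
  have advB : bmem (C i) (coords (adv x)).
    apply/(memE true); rewrite -roots ?grE //.
    by apply/(memE false).
  move/CP: advB; rewrite /B /= iE => -[cE].
  by apply: (col x (adv x) _ cE); split; [exact: adv_neq|left].
move=> pc; pose p i := wpath g i.+1.
have [|D cD] := r_codes (mkseq p n.+1); first by [].
have [m nm] := codes_path cD.
by rewrite -grE (pc m) ?E.
Qed.

(** The first term of the sequence strictly increases under [adv], so it is a continuous coloring;
    sequences indexed by [unit] serve as the discrete space of naturals. *)
Lemma chromatic_number_adv :
  borel_chromatic_number_is R (function_graph adv) [set: nat].
Proof.
split=> [|Y c pY cc]; last first.
  by apply/infiniteP; exact: finite_coloring_absurd pY cc.
pose Y := @baire_sub R unit setT.
pose c (x : X) : Y :=
  BaireSub R (P := setT) (fun _ : unit => elt (coords x) 0) I.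
have pY : polish_space R Y by exact: baire_polish.
have cc : borel_coloring (function_graph adv) c.
  split; last first.
    apply: continuous_borel_fun; apply: baire_continuous => -[].
    by exists (inr (inl 0)).
  move=> x y xy e.
  have kE : elt (coords (x : X)) 0 = elt (coords (y : X)) 0 :=
    congr1 (fun z : Y => coords z tt) e.
  case: xy => _ [xy|xy].
    by have := elt_adv_lt x; rewrite xy kE ltnn.
  by have := elt_adv_lt y; rewrite xy kE ltnn.
exists Y, c; split => //.
apply: Cantor_Bernstein; last first.
  by apply/infiniteP; exact: finite_coloring_absurd pY cc.
pose k (y : Y) := coords y tt.
have k_inj : {in range c &, injective k}.
  move=> y y' _ _ kE; apply: coords_inj; apply/funext => -[]; exact: kE.
rewrite -(card_le_eql (inj_card_eq k_inj)); exact: card_leT.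
Qed.

(** * No Borel homomorphism from the shift graph *)

Lemma iter_advance x k : elt (iter k advance x) =1 fun n => elt x (k + n).
Proof. by elim: k => // k IH n; rewrite iterS /elt /= -/(elt _ n.+1) IH addnS. Qed.

(* A path in the functional graph that escapes to infinity passes through the
   whole forward orbit of its origin. *)
Lemma escaping_path (x : nat -> bpoint) :
  (forall j n, elt (x j) n < elt (x j) n.+1) ->
  (forall j, x j.+1 = advance (x j) \/ x j = advance (x j.+1)) ->
  (forall K, exists j, K <= elt (x j) 0) ->
  forall k, exists2 j, k <= j & x j = iter k advance (x 0).
Proof.
move=> xS step unb k.
(* The path has visited the orbit of [x 0] up to iterate [a], and [x j] is [b] steps before that
   iterate. A backward step raises [b]; a forward step lowers [b] or, when [b] is 0, raises [a]. *)
have inv j : exists a b, (forall k, k <= a -> exists2 i, k <= i &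
    x i = iter k advance (x 0)) /\ iter b advance (x j) = iter a advance (x 0) /\ a <= j.
  elim: j => [|j [a [b [ha [hb aj]]]]].
    by exists 0, 0; split => // k'; rewrite leqn0 => /eqP ->; exists 0.
  case: (step j) => xj; last first.
    by exists a, b.+1; rewrite iterSr -xj; do !split => //; exact: ltnW.
  case: b hb => [|b] hb; last first.
    by exists a, b; rewrite xj -iterSr; do !split => //; exact: ltnW.
  exists a.+1, 0; split; last by rewrite /= xj -hb.
  move=> k'; rewrite leq_eqVlt => /orP[/eqP ->|/ha //].
  by exists j.+1 => //; rewrite xj iterS -hb.
(* Were [a < k], the first term of [x j] would be at most its term [b], which is term [a] of [x 0],
   hence at most [elt (x 0) k]. *)
have [j xj] := unb (elt (x 0) k).+1.
have [a [b [ha [hb _]]]] := inv j.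
apply: ha; rewrite leqNgt; apply/negP => ak.
have e := congr1 (fun z => elt z 0) hb; rewrite /= !iter_advance !addn0 in e.
have h1 := increasing_mono (xS j) (leq0n b).
have h2 := increasing_mono (xS 0) (ltnW ak).
by lia.
Qed.

Lemma drop_min_above j Y : unbounded Y -> drop_min j Y `<=` above j Y.
Proof.
move=> uY n nY; split; first exact: drop_min_sub nY.
have [_ /(_ n nY)] := min_natP (unbounded_drop_min j uY).
apply: leq_trans; apply: (increasing_geq (y := enumerate Y)) => i.
exact: enumerate_lt.
Qed.

Lemma infsub_iter_shift j A :
  infsub_set (iter j shift A) = drop_min j (infsub_set A).
Proof. by elim: j => // j IH; rewrite iterS infsub_shift IH. Qed.

(** On subsets of some [Z] the code is constant and the first term tends to infinity along the
    shift. For a sparse subset [A] of [Z] the sequence of [h A] lies above a refutation of that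
    code, against the recorded length. *)
Lemma no_borel_homomorphism (h : infsub -> X) : borel_fun h ->
  ~ graph_homomorphism shift_graph (function_graph adv) h.
Proof.
move=> bh hom; pose hh A : bpoint := coords (h A).
have hhS A n : elt (hh A) n < elt (hh A) n.+1 by have [+ _] := coordsP (h A); apply.
have step A : hh (shift A) = advance (hh A) \/ hh A = advance (hh (shift A)).
  have : shift_graph A (shift A).
    split; last by left.
    move=> /(congr1 infsub_set); rewrite infsub_shift => e.
    have [mA _] := min_natP (infsub_unbounded A).
    have : remove_min (infsub_set A) (min_nat (infsub_set A)) by rewrite -e.
    by case=> _; apply.
  by move=> /hom [_ [e|e]]; [left|right]; rewrite /hh -e.
have code_shift j A : bcode (hh (iter j shift A)) =1 bcode (hh A).
  elim: j => // j IH s; rewrite -IH iterS.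
  by case: (step (iter j shift A)) => ->.
pose P q : set (set nat) := carrier_sets [set A |
  if unpickle q is Some (i, m) then hh A i == m else false].
have RP q : ramsey (P q).
  apply/completely_ramsey_ramsey/borel_completely_ramsey.
  case: unpickle => [[i m]|]; last first.
    by rewrite (_ : mkset _ = set0); [exact: sigma_algebra0|apply/seteqP; split].
  have -> : [set A | hh A i == m] = h @^-1` [set x : X | coords x i = m].
    by apply/seteqP; split=> A /eqP.
  by apply: bh; apply: sub_sigma_algebra; exact: baire_open_eq.
have [Z [_ uZ hZ]] := ramsey_sequence RP unboundedT.
have {hZ} dich i m : exists a,
    (forall A, infsub_set A `<=` above a Z -> hh A i = m) \/
    (forall A, infsub_set A `<=` above a Z -> hh A i <> m).
  have [a aP] := hZ (pickle (i, m)); exists a.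
  have PE A : P (pickle (i, m)) (infsub_set A) <-> hh A i = m.
    by rewrite /P carrier_setsE /= pickleK; split=> /eqP.
  case: aP => aP; [left|right] => A AZ.
    by apply/PE; apply: aP => //; exact: infsub_unbounded.
  by move=> /PE; apply: aP => //; exact: infsub_unbounded.
have tail A a : infsub_set A `<=` Z -> infsub_set (iter a shift A) `<=` above a Z.
  move=> AZ; rewrite infsub_iter_shift.
  apply: subset_trans (drop_min_above (infsub_unbounded A)) _.
  exact: above_subset.
(* Shifting preserves the code, so both sets may be replaced by tails to which [dich] applies; a
   tail of [A] itself excludes the negative alternative. *)
have code_const A A' : infsub_set A `<=` Z -> infsub_set A' `<=` Z ->
    bcode (hh A) = bcode (hh A').
  move=> AZ A'Z; apply/funext => s.
  have [a [aP|aP]] := dich (inl s) (bcode (hh A) s).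
    by rewrite -[RHS](code_shift a); apply/esym/aP/tail.
  by case: (aP _ (tail A a AZ)); exact: (code_shift a A s).
(* A set and its shift have adjacent images, whose first terms differ; so a constant first term is
   impossible. *)
have elt_neq m : exists a, forall A, infsub_set A `<=` above a Z ->
    elt (hh A) 0 <> m.
  have [a [aP|aP]] := dich (inr (inl 0)) m; last by exists a.
  pose A := infsub_of (unbounded_above a uZ).
  have Am : elt (hh A) 0 = m by exact: aP.
  have SAm : elt (hh (shift A)) 0 = m by apply: aP => n [].
  have h1 := hhS A 0; have h2 := hhS (shift A) 0.
  case: (step A) => e; [move: SAm|move: Am]; rewrite e /elt /= -/(elt _ 1); lia.
have elt_big k : exists a, forall A, infsub_set A `<=` above a Z ->
    k <= elt (hh A) 0.
  elim: k => [|k [a aP]]; first by exists 0.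
  have [b bP] := elt_neq k; exists (maxn a b) => A AZ.
  have h1 := aP A (subset_trans AZ (above_mono (leq_maxl _ _))).
  have h2 := bP A (subset_trans AZ (above_mono (leq_maxr _ _))).
  by rewrite ltn_neqAle h1 andbT; apply/eqP => /esym.
have [b bP] := choice elt_big.
have [g rg] := refutes_exists (bcode (hh (infsub_of uZ))).
(* [escaping_path] yields some [j >= k], not [k] itself; the running maximum makes the bound at [j]
   cover [g k]. *)
pose gm n := \max_(i < n.+1) g i.
have g_le n : g n <= gm n by exact: (@leq_bigmax _ (fun i : 'I_n.+1 => g i) ord_max).
have gm_mono m n : m <= n -> gm m <= gm n.
  move=> mn; apply/bigmax_leqP => i _.
  have ilt : i < n.+1 by apply: leq_trans (ltn_ord i) _.
  exact: (@leq_bigmax _ (fun i : 'I_n.+1 => g i) (Ordinal ilt)).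
have /choice[z zP] (m : nat) : exists n, m <= n /\ Z n.
  by have [n mn Zn] := uZ m; exists n.
(* Term [n] is taken in [Z] beyond [b (gm n)], which forces the image of the [n]-th shift to start
   at or above [gm n]. *)
pose y := fix y n :=
  if n is n'.+1 then z (maxn (y n').+1 (b (gm n))) else z (b (gm 0)).
have yS n : y n < y n.+1.
  by have [+ _] := zP (maxn (y n).+1 (b (gm n.+1))); rewrite geq_max => /andP[].
have yb n : b (gm n) <= y n.
  case: n => [|n]; first by have [] := zP (b (gm 0)).
  by have [+ _] := zP (maxn (y n).+1 (b (gm n.+1))); rewrite geq_max => /andP[].
have yZ n : Z (y n) by case: n => [|n]; exact: (zP _).2.
pose A := infsub_of (unbounded_range yS).
have AZ : infsub_set A `<=` Z by move=> _ [n _ <-].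
pose x j := hh (iter j shift A).
have xb j : gm j <= elt (x j) 0.
  apply: bP; rewrite infsub_iter_shift drop_min_range // => _ [n _ <-].
  split=> //; apply: leq_trans (yb j) _.
  by apply: (increasing_mono yS); exact: leq_addr.
have xk k : g k <= elt (x 0) k.
  have [|j|K|j kj xj] := @escaping_path x _ _ _ k.
  - by move=> j n; exact: hhS.
  - by rewrite /x iterS; exact: step.
  - have [a aP] := elt_big K; exists a; apply: aP; exact: tail.
  have := xb j; rewrite xj iter_advance addn0; apply: leq_trans.
  exact: leq_trans (g_le k) (gm_mono _ _ kj).
(* At the recorded length no node of the tree lies below the sequence, yet the initial segment of
   [g] is such a node. *)
have [_ /(_ 0)[nd _]] := coordsP (h A).
apply: nd; exists (mkseq g (len (coords (h A)) 0)); split.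
- by rewrite size_mkseq.
- rewrite -/(hh A) (code_const A (infsub_of uZ)) //.
  exact: refutes_tree.
- by move=> i; rewrite size_mkseq => il; rewrite nth_mkseq //; exact: xk.
Qed.

End space.

Theorem theorem1 (R : realType) :
  exists (X : topologicalType) (f : X -> X),
    [/\ polish_space R X,
        continuous f,
        finite_to_one f,
        borel_chromatic_number_is R (function_graph f) [set: nat] &
        ~ exists h : infsub -> X,
            borel_fun h /\ graph_homomorphism shift_graph (function_graph f) h].
Proof.
exists (baire_sub R valid_point), (@adv R); split.
- by apply: baire_polish; exact: valid_point_closed.
- exact: adv_continuous.
- exact: adv_finite_to_one.
- exact: chromatic_number_adv.
- by move=> [h [bh hom]]; exact: no_borel_homomorphism hom.
Qed.
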